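(* Let $P \in \mathcal{P}^d(1)$ with $\operatorname{int}(P) \cap \mathbb{Z}^d = \{0\}$. Then $\operatorname{ca}(P, 0) \le s_{d+1} - 2$, with equality if and only if $P$ is unimodularly equivalent to $T^d_{1,d+1} = \operatorname{conv}(\{0, s_1e_1, \ldots, s_de_d\})$.
   Context: The Sylvester sequence: $s_1 = 2$, $s_i = \prod_{j=1}^{i-1} s_j + 1$ for $i\ge2$. $\mathcal{P}^d(1)$: $d$-dimensional polytopes in $\mathbb{R}^d$ with vertices in $\mathbb{Z}^d$ and exactly one integral point in the interior. For a $d$-dimensional convex body $K$ and $x\in\operatorname{int}K$, the coefficient of asymmetry is $\operatorname{ca}(K,x) := \max\{ \|a-x\|/\|b-x\| : a,b \in \partial K,\ x \in [a,b]\}$. Unimodular equivalence: existence of an affine bijection of $\mathbb{R}^d$ preserving $\mathbb{Z}^d$ mapping one onto the other. *)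

(* Defs.v *)
From Stdlib Require Import Reals.
From mathcomp Require Import all_boot.

Set Implicit Arguments.
Unset Strict Implicit.
Unset Printing Implicit Defensive.

Local Open Scope R_scope.

Definition vec (d : nat) := 'I_d -> R.

Definition vzero (d : nat) : vec d := fun _ => 0.
Arguments vzero d : clear implicits.
Definition vadd d (u v : vec d) : vec d := fun i => u i + v i.
Definition vsub d (u v : vec d) : vec d := fun i => u i - v i.
Definition vscale d (c : R) (u : vec d) : vec d := fun i => c * u i.

Definition vnorm d (u : vec d) : R :=
  sqrt (\big[Rplus/0]_(i < d) (u i * u i)).

Definition lattice d (u : vec d) : Prop := forall i, exists z : Z, u i = IZR z.

Definition int_set d (K : vec d -> Prop) (x : vec d) : Prop :=
  exists eps, 0 < eps /\ forall y, vnorm (vsub y x) < eps -> K y.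

Definition cl_set d (K : vec d -> Prop) (x : vec d) : Prop :=
  forall eps, 0 < eps -> exists y, K y /\ vnorm (vsub y x) < eps.

Definition bd_set d (K : vec d -> Prop) (x : vec d) : Prop :=
  cl_set K x /\ ~ int_set K x.

Definition segment d (a b : vec d) (x : vec d) : Prop :=
  exists t, 0 <= t <= 1 /\ x = vadd (vscale (1 - t) a) (vscale t b).

Definition conv d (V : seq (vec d)) (x : vec d) : Prop :=
  exists lam : nat -> R,
    (forall k, 0 <= lam k) /\
    \big[Rplus/0]_(k < size V) lam k = 1 /\
    forall i, x i = \big[Rplus/0]_(k < size V) (lam k * (nth (vzero d) V k) i).

Definition ca_values d (K : vec d -> Prop) (x : vec d) (r : R) : Prop :=
  exists a b, bd_set K a /\ bd_set K b /\ segment a b x /\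
    r = vnorm (vsub a x) / vnorm (vsub b x).

Definition is_ca d (K : vec d -> Prop) (x : vec d) (c : R) : Prop :=
  ca_values K x c /\ forall r, ca_values K x r -> r <= c.

(* Sylvester sequence: sylv_prod n = s_1 * ... * s_n, s_i = sylv_prod (i-1) + 1. *)
Fixpoint sylv_prod (n : nat) : nat :=
  match n with
  | O => 1%N
  | S m => (sylv_prod m * (sylv_prod m + 1))%N
  end.

(* s_n for n >= 1 (s_0 is a junk value, never used). *)
Definition sylvester (n : nat) : nat := (sylv_prod n.-1 + 1)%N.

Definition affine_map d (f : vec d -> vec d) : Prop :=
  exists (A : 'I_d -> 'I_d -> R) (t : vec d),
    forall x i, f x i = \big[Rplus/0]_(j < d) (A i j * x j) + t i.

Definition unimod_equiv d (K L : vec d -> Prop) : Prop :=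
  exists f : vec d -> vec d,
    affine_map f /\
    (forall y, exists x, f x = y) /\ (forall x x', f x = f x' -> x = x') /\
    (forall x, lattice x <-> lattice (f x)) /\
    (forall y, L y <-> exists x, K x /\ f x = y).

Definition simplexT (d : nat) : vec d -> Prop :=
  conv (vzero d :: [seq (fun j : 'I_d => if j == i then INR (sylvester i.+1) else 0)
                   | i <- enum 'I_d]).
Arguments simplexT d : clear implicits.

(* Main.v *)
(* Let [P] be the polytope. The asymmetry at the origin is attained by a vertex
   [v0] of [P] whose largest possible weight [M] in a convex combination of the
   vertices with value [0] is smallest, and it equals [1/M - 1]. By Caratheodory
   the weight [M] is reached on affinely independent vertices [v0, ..., vk],
   [k <= d], with positive weights; the relative interior of this lattice simplex
   lies in the interior of [P], so [0] is its only lattice point.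

   If [b_1 >= ... >= b_k] are the weights of [v1, ..., vk], then
   [b_1 ... b_j <= 1 - (b_1 + ... + b_j)] for all [j]: otherwise the pigeonhole
   principle (Minkowski's theorem for a parallelepiped, the weights being
   rational) gives a nonzero [n] in [Z^j], of sum [m >= 0], with
   [n_i < (m + 1) b_i], and [- sum_i n_i v_i] is another interior lattice point.
   These inequalities force [b_1 + ... + b_k <= 1/s_1 + ... + 1/s_k] by Abel
   summation and AM-GM, that is [M >= 1/(s_1 ... s_k)].

   In case of equality [k = d], [b_i = 1/s_i], the half-open box of the pigeonhole
   argument is a fundamental domain, so [v1, ..., vd] is a basis of the lattice
   and the simplex is equivalent to [simplexT d]. A vertex of [P] outside it would
   either contradict the maximality of [M] or make one of the lattice points
   [(1, ..., 1) - e_i] interior. *)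

Require Import Defs.
From Stdlib Require Import Reals.
From mathcomp Require Import all_boot all_order all_algebra archimedean.
From mathcomp Require Import boolp Rstruct ring lra zify.
Import Order.TTheory GRing.Theory Num.Theory.

Set Implicit Arguments.
Unset Strict Implicit.
Unset Printing Implicit Defensive.

(** * Sylvester numbers and the extremality of their reciprocals *)

Section SylvesterSequence.
Local Open Scope ring_scope.
Variable F : realFieldType.
Implicit Types x y z w : nat -> F.

Lemma sylv_prod_gt0 k : (0 < sylv_prod k)%N.
Proof. by elim: k => //= k IHk; rewrite muln_gt0 IHk addn1. Qed.

Lemma sylv_prod_gt1 k : (0 < k)%N -> (1 < sylv_prod k)%N.
Proof. by case: k => // k _; have := sylv_prod_gt0 k; rewrite /=; nia. Qed.

Lemma sylvesterE k : sylvester k.+1 = (sylv_prod k).+1.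
Proof. by rewrite /sylvester addn1. Qed.

Lemma sylvester_gt0 k : 0 < (sylvester k.+1)%:R :> F.
Proof. by rewrite sylvesterE ltr0n. Qed.

Lemma ltn_sylv_prod k l : (0 < k)%N -> (k < l)%N -> (sylv_prod k < sylv_prod l)%N.
Proof.
move=> k0; elim: l => // l IHl; rewrite ltnS leq_eqVlt => kl.
have lt_l : (sylv_prod l < sylv_prod l.+1)%N.
  by rewrite /= -[X in (X < _)%N]muln1 ltn_pmul2l ?sylv_prod_gt0 // addn1 ltnS sylv_prod_gt0.
by case/orP: kl => [/eqP -> //|/IHl /ltn_trans]; apply.
Qed.

Lemma sylv_prodE k : sylv_prod k = (\prod_(i < k) sylvester i.+1)%N.
Proof.
by elim: k => [|k IHk]; rewrite ?big_ord0 // big_ord_recr /= -IHk.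
Qed.

Lemma prod_inv_sylvester k :
  \prod_(i < k) (sylvester i.+1)%:R^-1 = (sylv_prod k)%:R^-1 :> F.
Proof. by rewrite sylv_prodE natr_prod prodfV. Qed.

Lemma sum_inv_sylvester k :
  \sum_(i < k) (sylvester i.+1)%:R^-1 = 1 - (sylv_prod k)%:R^-1 :> F.
Proof.
elim: k => [|k IHk]; first by rewrite big_ord0 invr1 subrr.
rewrite big_ord_recr /= {}IHk sylvesterE addn1 natrM -natr1.
have : 0 < (sylv_prod k)%:R :> F by rewrite ltr0n sylv_prod_gt0.
by move: _%:R => s s0; field; apply/andP; split; lra.
Qed.

(** Abel summation from the last index: the sum of [z] after [j] is nonpositive, so lowering its
    weight from [w j.+1] to [w j] only enlarges the bound. *)
Lemma sum_mul_tail_le k z w j :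
  (forall i, (i.+1 < k)%N -> w i <= w i.+1) ->
  (forall i, \sum_(i <= l < k) z l <= 0) -> (j < k)%N ->
  \sum_(j <= i < k) z i * w i <= w j * \sum_(j <= i < k) z i.
Proof.
move=> w_nd z_le0 jk; have [n kE] : exists n, k = (j + n).+1.
  by exists (k - j.+1)%N; lia.
elim: n j jk kE => [|n IHn] j jk kE.
  by rewrite kE addn0 !big_nat1 mulrC.
have jk' : (j.+1 < k)%N by rewrite kE; lia.
have {}IHn := IHn j.+1 jk' ltac:(lia).
rewrite !(big_ltn jk) mulrDr [w j * z j]mulrC lerD2l (le_trans IHn) //.
by rewrite ler_wnM2r // w_nd.
Qed.

(** * Products of sequences with dominated tail sums *)

Section TailDomination.
Variables (k : nat) (x y : nat -> F).
Hypotheses (x_gt0 : forall i, (i < k)%N -> 0 < x i)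
  (y_gt0 : forall i, (i < k)%N -> 0 < y i)
  (x_nincr : forall i, (i.+1 < k)%N -> x i.+1 <= x i)
  (le_tail : forall j, \sum_(j <= i < k) y i <= \sum_(j <= i < k) x i).

Let ratio_ge0 (i : 'I_k) : 0 <= y i / x i.
Proof. by rewrite divr_ge0 // ltW // ?x_gt0 ?y_gt0. Qed.

(** Abel summation of the differences [y i - x i] against the nondecreasing weights [(x i)^-1]. *)
Let sum_ratio_le : \sum_(i < k) y i / x i <= k%:R.
Proof.
case: k x_gt0 y_gt0 x_nincr le_tail => [|k'] x0 y0 xn lt; first by rewrite big_ord0.
have z_le0 i : \sum_(i <= l < k'.+1) (y l - x l) <= 0.
  by rewrite sumrB subr_le0.
have w_nd i : (i.+1 < k'.+1)%N -> (x i)^-1 <= (x i.+1)^-1.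
  by move=> ik; rewrite lef_pV2 ?posrE ?x0 ?xn // ltnW.
have := sum_mul_tail_le w_nd z_le0 (ltn0Sn k').
rewrite big_mkord (eq_bigr (fun i : 'I_k'.+1 => y i / x i - 1)); last first.
  by move=> i _; rewrite mulrBl divff // gt_eqF // x0.
rewrite sumrB sumr_const card_ord => le; rewrite -subr_le0 (le_trans le) //.
by rewrite mulr_ge0_le0 // invr_ge0 ltW // x0.
Qed.

Let mean_ratio_le : ((\sum_(i < k) y i / x i) / k%:R) ^+ k <= 1.
Proof.
rewrite exprn_ile1 //; first by rewrite divr_ge0 ?ler0n // sumr_ge0.
by case: (posnP k) => [->|k0]; rewrite ?invr0 ?mulr0 // ler_pdivrMr ?ltr0n // mul1r.
Qed.

Let prod_ratio : \prod_(i < k) y i = \prod_(i < k) (y i / x i) * \prod_(i < k) x i.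
Proof. by rewrite -big_split; apply: eq_bigr => i _; rewrite /= divfK // gt_eqF ?x_gt0. Qed.

Let prodx_gt0 : 0 < \prod_(i < k) x i.
Proof. by apply: prodr_gt0 => i _; apply: x_gt0. Qed.

Let ratio_AGM : \prod_(i < k) (y i / x i) <= ((\sum_(i < k) y i / x i) / k%:R) ^+ k
  ?= iff [forall i : 'I_k, forall j : 'I_k, y i / x i == y j / x j].
Proof.
have := leif_AGM (A := 'I_k) (in1W ratio_ge0); rewrite card_ord.
by rewrite (eq_bigl xpredT) // [X in _ <= (X / _) ^+ _ ?= iff _](eq_bigl xpredT).
Qed.

(** By AM-GM the product of the ratios [y i / x i] is at most the [k]-th power of their mean, and
    the mean is at most 1. *)
Lemma tail_dominated_prod_le : \prod_(i < k) y i <= \prod_(i < k) x i.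
Proof.
rewrite prod_ratio ler_piMl //; first exact: ltW.
exact: le_trans ratio_AGM.1 mean_ratio_le.
Qed.

(** The reverse inequality forces equality in AM-GM, so all ratios agree, and their common [k]-th
    power is 1. *)
Lemma tail_dominated_prod_eq :
  \prod_(i < k) x i <= \prod_(i < k) y i -> forall i, (i < k)%N -> x i = y i.
Proof.
move=> le_xy.
have prod1 : \prod_(i < k) (y i / x i) = 1.
  apply: (mulIf (lt0r_neq0 prodx_gt0)); rewrite -prod_ratio mul1r.
  by apply/eqP; rewrite eq_le le_xy tail_dominated_prod_le.
have [le_agm eq_agm] := ratio_AGM.
have all_eq : forall i j : 'I_k, y i / x i = y j / x j.
  have /forallP h : [forall i : 'I_k, forall j : 'I_k, y i / x i == y j / x j].
    by rewrite -eq_agm eq_le le_agm prod1 mean_ratio_le.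
  by move=> i j; apply/eqP; have /forallP := h i; apply.
move=> i ik; have : (y i / x i) ^+ k = 1.
  rewrite -prod1 (eq_bigr (fun=> y i / x i)); last by move=> j _; rewrite (all_eq j (Ordinal ik)).
  by rewrite prodr_const card_ord.
move/eqP; rewrite pexprn_eq1 ?(ratio_ge0 (Ordinal ik)) // => /orP[/eqP k0|/eqP r1].
  by rewrite k0 in ik.
by rewrite -[LHS]mul1r -r1 divfK // gt_eqF ?x_gt0.
Qed.

End TailDomination.

(** * Sums constrained by product inequalities *)

Section ProductInequalities.
Variables (k : nat) (x : nat -> F).
Hypotheses (x_gt0 : forall i, (i < k)%N -> 0 < x i)
  (x_nincr : forall i, (i.+1 < k)%N -> x i.+1 <= x i)
  (prod_le : forall j, (j <= k)%N -> \prod_(i < j) x i <= 1 - \sum_(i < j) x i).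

Let y i : F := (sylvester i.+1)%:R^-1.

Let y_gt0 i : 0 < y i. Proof. by rewrite invr_gt0 sylvester_gt0. Qed.

Let tail_le j : (j <= k)%N -> \sum_(i < j) y i <= \sum_(i < j) x i ->
  (forall l, (l < j)%N -> \sum_(i < l) x i <= \sum_(i < l) y i) ->
  forall l, \sum_(l <= i < j) y i <= \sum_(l <= i < j) x i.
Proof.
move=> jk le_j le_lt l; case: (ltnP l j) => [lj|jl]; last by rewrite !big_geq.
have split (u : nat -> F) : \sum_(i < j) u i = \sum_(i < l) u i + \sum_(l <= i < j) u i.
  by rewrite -!(big_mkord xpredT u) -big_cat_nat // ltnW.
by have := le_lt _ lj; have := le_j; rewrite !split; lra.
Qed.

(* If the first [j] terms had a larger sum than [sum_i 1/s_i] then, the shorter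
   prefixes being dominated, the tails would dominate instead, and the product
   of the [x i] would be at least [prod_i 1/s_i = 1 - sum_i 1/s_i]. *)
Lemma sum_le_sylvester j : (j <= k)%N ->
  \sum_(i < j) x i <= \sum_(i < j) (sylvester i.+1)%:R^-1.
Proof.
elim/ltn_ind: j => j IHj jk; rewrite leNgt; apply/negP => lt_j.
have := tail_dominated_prod_le (k := j) (x := x) (y := y)
  (fun i ij => x_gt0 (leq_trans ij jk)) (fun i _ => y_gt0 i)
  (fun i ij => x_nincr (leq_trans ij jk))
  (tail_le jk (ltW lt_j) (fun l lj => IHj l lj (leq_trans (ltnW lj) jk))).
have := prod_le jk; move: lt_j; rewrite /y prod_inv_sylvester sum_inv_sylvester; lra.
Qed.

(** Equal totals and dominated prefixes make the tails dominate, while [prod_le] at [k] bounds the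
    product of the [x i] by that of the reciprocals: this is the equality case of the AM-GM
    comparison. *)
Lemma sum_eq_sylvester : \sum_(i < k) x i = \sum_(i < k) (sylvester i.+1)%:R^-1 ->
  forall i, (i < k)%N -> x i = (sylvester i.+1)%:R^-1.
Proof.
move=> eq_k; apply: (@tail_dominated_prod_eq k x y) => //.
  apply: tail_le => // [|l lk]; first by rewrite eq_k.
  exact/sum_le_sylvester/ltnW.
by rewrite /y prod_inv_sylvester (le_trans (prod_le (leqnn k))) // eq_k sum_inv_sylvester; lra.
Qed.

End ProductInequalities.

End SylvesterSequence.

(** * Pigeonhole principle for a box of integer vectors *)

Section Pigeonhole.
Local Open Scope ring_scope.
Variables (j N r : nat) (q : 'I_j.+1 -> nat).
Hypotheses (r_gt0 : (0 < r)%N) (sum_q : (\sum_i q i + r)%N = N).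
Implicit Types u n : 'I_j.+1 -> int.

(* [N] times the vector [n_i - (sum_l n_l) beta_i], where [beta_i = q_i / N]. *)
Definition skew n i : int := N%:Z * n i - (\sum_l n l) * (q i)%:Z.

Let N_gt0 : (0 < N)%N. Proof. by rewrite -sum_q addn_gt0 r_gt0 orbT. Qed.

(** The successor form [m.-1.+1] is what [inord] needs; it equals [m] for positive [m]. *)
Let residue (m : nat) (x : int) : 'I_m.-1.+1 := inord `|(x %% m)%Z|%N.

Let residue_eq m x y : (0 < m)%N -> residue m x = residue m y ->
  (m%:Z %| x - y)%Z.
Proof.
case: m => // m _ /(congr1 val) /=.
have lt_m z : (`|(z %% m.+1)%Z|%N < m.+1)%N.
  by rewrite -ltz_nat gez0_abs ?modz_ge0 // ltz_pmod.
rewrite !inordK // => /(congr1 Posz); rewrite !gez0_abs ?modz_ge0 // => /eqP.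
by rewrite eqz_mod_dvd.
Qed.

Let quot u : int := ((\sum_i u i) %/ r)%Z.

(* Two integer vectors in the same class differ by an element of the lattice
   [skew @ Z^(j+1)]; the last coordinate needs no residue because the sum of all
   of them is controlled by the first component. *)
Let class u : 'I_r.-1.+1 * {ffun 'I_j -> 'I_N.-1.+1} :=
  (residue r (\sum_i u i),
   [ffun i : 'I_j => residue N (u (widen_ord (leqnSn j) i)
      + quot u * (q (widen_ord (leqnSn j) i))%:Z)]).

Let class_eq u u' : class u = class u' ->
  exists n, forall i, u i - u' i = skew n i.
Proof.
case=> /(residue_eq r_gt0) dvd_r /ffunP eq_res.
pose m := quot u - quot u'.
have sum_m : \sum_i u i - \sum_i u' i = m * r%:Z.
  have /eqP mod_eq : (\sum_i u i == \sum_i u' i %[mod r])%Z by rewrite eqz_mod_dvd.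
  rewrite (divz_eq (\sum_i u i) r) (divz_eq (\sum_i u' i) r) mod_eq /m /quot; ring.
(* If [u - u'] is [skew n], summing the coordinates gives [m = \sum_l n l], hence [D i = N * n i];
   so [n] has to be [D / N]. *)
pose D i := u i - u' i + m * (q i)%:Z.
have sumD : \sum_i D i = m * N%:Z.
  rewrite big_split /= sumrB sum_m -mulr_sumr -sum_q PoszD mulrDr addrC.
  rewrite -[Posz (\sum_i q i)%N]natz natr_sum.
  by congr (_ * _ + _); apply: eq_bigr => i _; rewrite natz.
have dvdD_w i : (N%:Z %| D (widen_ord (leqnSn j) i))%Z.
  have := eq_res i; rewrite !ffunE => /(residue_eq N_gt0).
  by congr (_ %| _)%Z; rewrite /D /m; ring.
have dvdD i : (N%:Z %| D i)%Z.
  case: (unliftP ord_max i) => [i'|] ->.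
    have -> : lift ord_max i' = widen_ord (leqnSn j) i' by apply/val_inj/lift_max.
    exact: dvdD_w.
  move: sumD; rewrite big_ord_recr /= => /(canRL (addKr _)) ->.
  by rewrite rpredD ?rpredN ?rpred_sum // dvdz_mull.
exists (fun i => (D i %/ N)%Z) => i; rewrite /skew mulrC divzK ?dvdD //.
have -> : \sum_l (D l %/ N)%Z = m.
  apply: (@mulIf _ N%:Z); first by rewrite eqz_nat -lt0n.
  by rewrite -sumD mulr_suml; apply: eq_bigr => l _; rewrite divzK ?dvdD.
by rewrite /D addrK.
Qed.

Hypothesis skew_free :
  forall n, (forall i, `|skew n i| < (q i)%:Z) -> forall i, n i = 0.

Let box_class (b : {dffun forall i : 'I_j.+1, 'I_(q i)}) := class (fun i => (b i : nat)%:Z).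

Let box_class_inj : injective box_class.
Proof.
move=> b b' /class_eq[n bb']; apply/ffunP => i; apply/val_inj/eqP.
rewrite -eqz_nat -subr_eq0 bb'.
have n0 : forall l, n l = 0.
  apply: skew_free => l; rewrite -bb'; have := ltn_ord (b l); have := ltn_ord (b' l); lia.
by rewrite /skew big1 ?n0 ?mulr0 ?mul0r ?subr0.
Qed.

Let card_box : #|{dffun forall i : 'I_j.+1, 'I_(q i)}| = (\prod_i q i)%N.
Proof.
by rewrite card_dep_ffun foldrE big_image; apply: eq_bigr => i _; rewrite card_ord.
Qed.

Let card_class : #|{: 'I_r.-1.+1 * {ffun 'I_j -> 'I_N.-1.+1}}| = (r * N ^ j)%N.
Proof. by rewrite card_prod card_ffun !card_ord !prednK. Qed.

(** Two box points in one class differ by some [skew n] with entries below [q i] in absolute value;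
    then [n] vanishes and the points coincide. *)
Lemma skew_free_prod_le : (\prod_i q i <= r * N ^ j)%N.
Proof. by rewrite -card_box -card_class; apply: leq_card box_class_inj. Qed.

(** With at least as many box points as classes the injection is onto: the translates of the box by
    the vectors [skew n] cover all integer vectors. *)
Lemma skew_free_covering u : (r * N ^ j <= \prod_i q i)%N ->
  exists n, forall i, 0 <= u i - skew n i < (q i)%:Z.
Proof.
rewrite -card_box -card_class => card_le.
have /codomP[b /class_eq[n Eb]] := inj_card_onto box_class_inj card_le (class u).
exists n => i; by rewrite -Eb subKr lez_nat ltz_nat ltn_ord.
Qed.

End Pigeonhole.

(** * Closure properties of integer matrices *)

Section IntegerMatrices.
Local Open Scope ring_scope.
Variable R : archiRealFieldType.

Lemma mxOver_intN m n (A : 'M[R]_(m, n)) :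
  A \is a mxOver Num.int -> - A \is a mxOver Num.int.
Proof. by move/mxOverP => A_int; apply/mxOverP => i l; rewrite mxE rpredN. Qed.

Lemma mxOver_intD m n (A B : 'M[R]_(m, n)) : A \is a mxOver Num.int ->
  B \is a mxOver Num.int -> A + B \is a mxOver Num.int.
Proof.
by move=> /mxOverP A_int /mxOverP B_int; apply/mxOverP => i l; rewrite mxE rpredD.
Qed.

Lemma mxOver_intM m n p (A : 'M[R]_(m, n)) (B : 'M[R]_(n, p)) :
  A \is a mxOver Num.int -> B \is a mxOver Num.int ->
  A *m B \is a mxOver Num.int.
Proof.
move=> /mxOverP A_int /mxOverP B_int; apply/mxOverP => i l.
by rewrite mxE rpred_sum // => l' _; rewrite rpredM.
Qed.

End IntegerMatrices.

(** * Weights of the origin in a lattice simplex *)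

Section LatticeSimplex.
Local Open Scope ring_scope.
Variables (R : archiRealFieldType) (d k : nat).
Variables (v : 'M[R]_(k, d)) (v0 : 'rV[R]_d) (b : nat -> R) (b0 : R).
Let bv : 'rV[R]_k := \row_i b i.
Hypotheses (v_int : v \is a mxOver Num.int) (v0_int : v0 \is a mxOver Num.int)
  (b_gt0 : forall i, (i < k)%N -> 0 < b i) (b0_gt0 : 0 < b0)
  (sum_b : \sum_(i < k) b i + b0 = 1) (comb_b : bv *m v + b0 *: v0 = 0)
  (aff_free : forall (a : 'rV[R]_k) a0, \sum_i a 0 i + a0 = 0 ->
     a *m v + a0 *: v0 = 0 -> a = 0 /\ a0 = 0)
  (interior0 : forall (a : 'rV[R]_k) a0, (forall i, 0 < a 0 i) -> 0 < a0 ->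
     \sum_i a 0 i + a0 = 1 -> a *m v + a0 *: v0 \is a mxOver Num.int ->
     a *m v + a0 *: v0 = 0).

(** The lattice point [- (y *m v)] has the barycentric coordinates [(s + 1) * b i - y i] and
    [(s + 1) * b0], all positive, so it is the origin. Uniqueness of the coordinates then gives
    [s * b0 = 0], and [y = 0]. *)
Lemma half_short_eq0 (y : 'rV[R]_k) : 0 <= \sum_i y 0 i ->
  (forall i, y 0 i < (\sum_l y 0 l + 1) * b i) ->
  y *m v \is a mxOver Num.int -> y = 0.
Proof.
set s := \sum_i y 0 i => s_ge0 y_lt yv_int.
pose a := (s + 1) *: bv - y.
have pointE : a *m v + ((s + 1) * b0) *: v0 = - (y *m v).
  rewrite mulmxBl -scalemxAl -scalerA addrAC -scalerDr comb_b scaler0.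
  by rewrite sub0r.
have suma : \sum_i a 0 i = (s + 1) * (1 - b0) - s.
  have -> : 1 - b0 = \sum_(i < k) b i by have := sum_b; lra.
  rewrite (eq_bigr (fun i : 'I_k => (s + 1) * b i - y 0 i)).
    by rewrite sumrB -mulr_sumr.
  by move=> i _; rewrite !mxE.
have point0 : a *m v + ((s + 1) * b0) *: v0 = 0.
  apply: interior0; last by rewrite pointE mxOver_intN.
  - by move=> i; rewrite !mxE subr_gt0 y_lt.
  - by rewrite mulr_gt0 // ltr_wpDl.
  - by rewrite suma; ring.
have [] := aff_free (a := a - bv) (a0 := s * b0).
- rewrite (eq_bigr (fun i : 'I_k => a 0 i - b i)); last by move=> i _; rewrite !mxE.
  by rewrite sumrB suma; have := sum_b; lra.
- have -> : s * b0 = (s + 1) * b0 - b0 by ring.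
  by rewrite mulmxBl scalerBl addrACA point0 -opprD comb_b subrr.
move=> ab /eqP; rewrite mulf_eq0 (gt_eqF b0_gt0) orbF => /eqP s0.
by move: ab; rewrite /a s0 add0r scale1r addrAC subrr sub0r => /eqP; rewrite oppr_eq0 => /eqP.
Qed.

(** Up to replacing [y] by [- y] the sum is nonnegative, and the previous lemma applies. The
    predicate [P] allows a vector supported on a prefix of the vertices. *)
Lemma short_eq0 (P : pred 'I_k) (y : 'rV[R]_k) :
  (forall i, ~~ P i -> y 0 i = 0) ->
  (forall i, P i -> `|y 0 i - (\sum_l y 0 l) * b i| < b i) ->
  y *m v \is a mxOver Num.int -> y = 0.
Proof.
move=> yP0 yP yv_int.
have short_lt (s : R) (z : 'rV[R]_k) : 0 <= s -> (forall i, ~~ P i -> z 0 i = 0) ->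
    (forall i, P i -> `|z 0 i - s * b i| < b i) ->
    forall i, z 0 i < (s + 1) * b i.
  move=> s0 zP0 zP i; case: (boolP (P i)) => [/zP|/zP0 ->].
    by rewrite ltr_norml mulrDl mul1r => /andP[_]; lra.
  by rewrite mulr_gt0 ?b_gt0 // ltr_wpDl.
have [s_ge0|s_lt0] := lerP 0 (\sum_i y 0 i).
  by apply: half_short_eq0 => //; apply: short_lt.
have sumN : \sum_i (- y) 0 i = - \sum_i y 0 i.
  by rewrite -sumrN; apply: eq_bigr => i _; rewrite mxE.
apply: oppr_inj; rewrite oppr0; apply: half_short_eq0.
- by rewrite sumN oppr_ge0 ltW.
- rewrite sumN; apply: short_lt => [|i /yP0 yi|i /yP]; first by rewrite oppr_ge0 ltW.
    by rewrite mxE yi oppr0.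
  by rewrite mxE mulNr -opprD normrN.
- by rewrite mulNmx mxOver_intN.
Qed.

(* The weights solve a linear system with integer coefficients and a unique
   solution, hence are rational. *)
Lemma weights_rational : exists2 N : nat, (0 < N)%N &
  forall i, (i < k)%N -> N%:R * b i \is a Num.int.
Proof.
(* The extra column of ones turns affine independence into linear independence of the rows. *)
pose U : 'M[R]_(k + 1, d + 1) := row_mx (col_mx v v0) (const_mx 1).
pose e : 'rV[R]_(d + 1) := row_mx 0 (const_mx 1).
have mulU (a : 'rV[R]_k) (a0 : 'rV[R]_1) :
    row_mx a a0 *m U = row_mx (a *m v + a0 0 0 *: v0) (const_mx (\sum_i a 0 i + a0 0 0)).
  rewrite /U mul_mx_row mul_row_col [a0]mx11_scalar mul_scalar_mx mxE mulr1n.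
  congr row_mx; apply/rowP => i; rewrite !mxE big_split_ord /= big_ord1.
  rewrite row_mxEr !mxE mulr1 mulr1n; congr (_ + _).
  by apply: eq_bigr => l _; rewrite row_mxEl mxE mulr1.
have freeU : row_free U.
  apply: inj_row_free => a; rewrite -[a]hsubmxK mulU -[X in _ = X]row_mx0.
  move=> /eq_row_mx[eq0 /rowP/(_ 0)]; rewrite mxE [RHS]mxE => sum0.
  have [-> a0] := aff_free sum0 eq0.
  by rewrite -[RHS]row_mx0; congr row_mx; apply/rowP => i; rewrite [i]ord1 a0 mxE.
have bU : row_mx bv (const_mx b0) *m U = e.
  rewrite mulU [const_mx b0 0 0]mxE comb_b; congr (row_mx _ (const_mx _)).
  by rewrite -[RHS]sum_b; congr (_ + _); apply: eq_bigr => i _; rewrite mxE.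
have U_int : U \is a mxOver Num.int.
  apply/mxOverP => i l; rewrite mxE; case: splitP => l' _; last by rewrite mxE rpred1.
  rewrite mxE; case: splitP => i' _; exact/mxOverP.
have int_rat m n (A : 'M[R]_(m, n)) : A \is a mxOver Num.int ->
    A = map_mx ratr (map_mx (fun x => (Num.floor x)%:~R) A).
  by move/mxOverP => A_int; apply/matrixP => i l; rewrite !mxE ratr_int floorK.
have e_int : e \is a mxOver Num.int.
  by apply/mxOverP => i l; rewrite mxE; case: splitP => l' _; rewrite mxE ?rpred0 ?rpred1.
(* Solvability descends from the reals to the rationals, and freeness of [U] identifies the rational
   solution with the weights. *)
have : (e <= U)%MS by rewrite -bU submxMl.
rewrite (int_rat _ _ _ U_int) (int_rat _ _ _ e_int) map_submx => /submxP[D eD].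
have bD : row_mx bv (const_mx b0) = map_mx ratr D.
  apply: (row_free_inj freeU); rewrite bU (int_rat _ _ _ e_int) eD map_mxM.
  by rewrite -(int_rat _ _ _ U_int).
pose N := (\prod_i `|denq (D 0%R i)|)%N.
have ND i : N%:R * (ratr (D 0 i) : R) \is a Num.int.
  rewrite /N (bigD1 i) //= mulnC natrM -mulrA rpredM ?rpred_nat //.
  rewrite -(ratr_nat _ `|denq (D 0 i)|) -rmorphM /= pmulrn absz_denq mulrC -numqE.
  by rewrite ratr_int intr_int.
exists N => [|i ik]; first by apply: prodn_gt0 => i; rewrite absz_gt0 denq_neq0.
have /rowP/(_ (lshift 1 (Ordinal ik))) := bD.
by rewrite row_mxEl !mxE /= => ->.
Qed.

Let b_ge0 i : (i < k)%N -> 0 <= b i. Proof. by move/b_gt0/ltW. Qed.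

(** * Pigeonhole applied to the weights over a common denominator *)

Section CommonDenominator.
Variable N : nat.
Hypotheses (N_gt0 : (0 < N)%N) (Nb : forall i, (i < k)%N -> N%:R * b i \is a Num.int).

Let q i := Num.trunc (N%:R * b i).
Let r j := (N - \sum_(i < j) q i)%N.

Let NR_gt0 : 0 < N%:R :> R. Proof. by rewrite ltr0n. Qed.

Let qE i : (i < k)%N -> (q i)%:R = N%:R * b i.
Proof.
by move=> ik; apply: truncnK; rewrite natrEint Nb //= mulr_ge0 ?ltW // b_gt0.
Qed.

Let sum_prefix_lt1 j : (j <= k)%N -> \sum_(i < j) b i < 1.
Proof.
move=> jk; rewrite -sum_b ltr_pwDr // (big_ord_widen _ b jk).
rewrite [X in _ <= X](bigID (fun i : 'I_k => (i < j)%N)) /= lerDl sumr_ge0 // => i _.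
exact: b_ge0.
Qed.

Let sum_q_real j : (j <= k)%N -> (\sum_(i < j) q i)%:R = N%:R * \sum_(i < j) b i.
Proof.
move=> jk; rewrite natr_sum mulr_sumr; apply: eq_bigr => i _.
by rewrite qE // (leq_trans (ltn_ord i)).
Qed.

Let sum_q_lt j : (j <= k)%N -> (\sum_(i < j) q i < N)%N.
Proof.
by move=> jk; rewrite -(ltr_nat R) sum_q_real // gtr_pMr // sum_prefix_lt1.
Qed.

Let sum_qr j : (j <= k)%N -> (\sum_(i < j) q i + r j)%N = N.
Proof. by move=> jk; rewrite subnKC // ltnW // sum_q_lt. Qed.

Let rE j : (j <= k)%N -> (r j)%:R = N%:R * (1 - \sum_(i < j) b i).
Proof.
by move=> jk; rewrite mulrBr mulr1 -sum_q_real // -natrB // ltnW // sum_q_lt.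
Qed.

Let prod_qE j : (j <= k)%N -> (\prod_(i < j) q i)%:R = N%:R ^+ j * \prod_(i < j) b i.
Proof.
move=> jk; rewrite natr_prod (eq_bigr (fun i : 'I_j => N%:R * b i)).
  by rewrite big_split /= prodr_const card_ord.
by move=> i _; rewrite qE // (leq_trans (ltn_ord i)).
Qed.

Let prefix_skew_free j (n : 'I_j.+1 -> int) : (j < k)%N ->
  (forall i, `|skew N (fun i : 'I_j.+1 => q i) n i| < (q i)%:Z) -> forall i, n i = 0.
Proof.
move=> jk n_short.
(* [n] extended by zero; divided by [N], its shortness is the hypothesis of [short_eq0]. *)
pose y : 'rV[R]_k := \row_i (if (i < j.+1)%N then n (inord i) else 0)%:~R.
have sumy : \sum_i y 0 i = (\sum_i n i)%:~R.
  rewrite (eq_bigr (fun i : 'I_k => if (i < j.+1)%N then (n (inord i))%:~R else 0)).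
    rewrite -big_mkcond -(big_ord_widen _ (fun i => (n (inord i))%:~R : R) jk) rmorph_sum.
    by apply: eq_bigr => i _; rewrite inord_val.
  by move=> i _; rewrite mxE; case: ifP.
have y0 : y = 0.
  apply: (@short_eq0 (fun i => (i < j.+1)%N)).
  - by move=> i /negPf; rewrite mxE => ->.
  - move=> i ij; rewrite sumy mxE ij.
    have := n_short (inord i); rewrite /skew inordK // -(ltr_int R) intr_norm.
    rewrite rmorphB !rmorphM /= -!pmulrn qE // => lt_b.
    rewrite -(ltr_pM2l NR_gt0) -[X in X * `|_|](ger0_norm (ltW NR_gt0)) -normrM.
    by move: lt_b; congr (`|_| < _); ring.
  - by rewrite mxOver_intM //; apply/mxOverP => i l; rewrite mxE intr_int.
move=> i; have := congr1 (fun M : 'rV[R]_k => M 0 (widen_ord jk i)) y0.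
by rewrite !mxE /= ltn_ord inord_val => /eqP; rewrite intr_eq0 => /eqP.
Qed.

(** For positive [j] this is the pigeonhole bound [\prod q <= r * N ^ (j - 1)] divided by
    [N ^ j]. *)
Lemma prefix_prod_le_denom j : (j <= k)%N -> \prod_(i < j) b i <= 1 - \sum_(i < j) b i.
Proof.
case: j => [_|j jk]; first by rewrite !big_ord0 subr0.
have r_gt0 : (0 < r j.+1)%N by rewrite subn_gt0 sum_q_lt.
have := skew_free_prod_le r_gt0 (sum_qr jk) (fun n => @prefix_skew_free j n jk).
rewrite -(ler_nat R) prod_qE // natrM natrX rE // mulrAC -exprS.
by rewrite ler_pM2l ?exprn_gt0.
Qed.

(** Tightness gives the box as many points as there are classes, so an integer vector [n] can be
    subtracted from [z] to leave a short [y], which vanishes. *)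
Lemma tight_coord_int_denom (z : 'rV[R]_k) : b0 <= \prod_(i < k) b i ->
  z *m v \is a mxOver Num.int -> z \is a mxOver Num.int.
Proof.
move=> tight zv_int.
have [k0|k_gt0] := posnP k.
  by apply/mxOverP => i [l lk]; exfalso; rewrite k0 in lk.
have jk : (k.-1 < k)%N by rewrite prednK.
have r_gt0 : (0 < r k.-1.+1)%N by rewrite subn_gt0 sum_q_lt.
have card_le : (r k.-1.+1 * N ^ k.-1 <= \prod_(i < k.-1.+1) q i)%N.
  rewrite -(ler_nat R) prod_qE // natrM natrX rE // mulrAC -exprS.
  rewrite ler_pM2l ?exprn_gt0 // prednK // (le_trans _ tight) //.
  by have := sum_b; lra.
pose s := \sum_i z 0 i.
(* The covering concerns integer vectors, hence the floor. Since [skew n] and [q] are integral, the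
   bounds on [u] carry over to the real numbers below the floor sign. *)
pose u (i : 'I_k.-1.+1) := Num.floor (N%:R * (z 0 (widen_ord jk i) - s * b i)).
have [n nP] := skew_free_covering r_gt0 (sum_qr jk)
  (fun n => @prefix_skew_free _ n jk) u card_le.
pose y : 'rV[R]_k := \row_i (z 0 i - (n (inord i))%:~R).
have n_int : (\row_(i < k) (n (inord i))%:~R : 'rV[R]_k) \is a mxOver Num.int.
  by apply/mxOverP => i l; rewrite mxE intr_int.
have sumn : \sum_(i < k) (n (inord i))%:~R = (\sum_i n i)%:~R :> R.
  pose g i : R := (n (inord i))%:~R.
  have -> : \sum_(i < k) (n (inord i))%:~R = \sum_(i < k.-1.+1) g i by rewrite prednK.
  by rewrite rmorph_sum; apply: eq_bigr => i _; rewrite /g inord_val.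
have sumy : \sum_i y 0 i = s - (\sum_i n i)%:~R.
  rewrite -sumn /s -sumrB; apply: eq_bigr => i _; by rewrite mxE.
have yE : y = z - \row_(i < k) (n (inord i))%:~R by apply/rowP => i; rewrite !mxE.
suff y0 : y = 0 by move/eqP: y0; rewrite yE subr_eq0 => /eqP ->.
apply: (@short_eq0 xpredT) => // [i _|]; last first.
  by rewrite yE mulmxBl mxOver_intD // mxOver_intN // mxOver_intM.
have := nP (inord i); rewrite /u /skew.
have ii : (i < k.-1.+1)%N by rewrite prednK.
have -> : widen_ord jk (inord i) = i by apply/val_inj; rewrite /= inordK.
rewrite inordK // -lezD1 -!(ler_int R) !(rmorphD, rmorphN, rmorphM) /= -!pmulrn qE //.
rewrite sumy mxE; set fl := Num.floor _.
have := floor_le (N%:R * (z 0 i - s * b i)); have := floorD1_gt (N%:R * (z 0 i - s * b i)).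
rewrite -/fl rmorphD /= => lt_fl le_fl /andP[n_ge n_lt].
move: n_ge n_lt; set m := (\sum_l n l)%:~R; set ni := (n _)%:~R => n_ge n_lt.
rewrite ltr_norml -(ltr_pM2l NR_gt0) -[X in _ && X](ltr_pM2l NR_gt0).
by apply/andP; split; nra.
Qed.

End CommonDenominator.

Lemma prefix_prod_le j : (j <= k)%N -> \prod_(i < j) b i <= 1 - \sum_(i < j) b i.
Proof.
have [N N_gt0 Nb] := weights_rational.
exact: prefix_prod_le_denom N_gt0 Nb j.
Qed.

Lemma tight_coord_int (z : 'rV[R]_k) : b0 <= \prod_(i < k) b i ->
  z *m v \is a mxOver Num.int -> z \is a mxOver Num.int.
Proof.
have [N N_gt0 Nb] := weights_rational.
exact: tight_coord_int_denom N_gt0 Nb z.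
Qed.

Hypothesis b_nincr : forall i, (i.+1 < k)%N -> b i.+1 <= b i.

Lemma apex_weight_ge : (sylv_prod k)%:R^-1 <= b0.
Proof.
have := sum_le_sylvester b_gt0 b_nincr prefix_prod_le (leqnn k).
by rewrite sum_inv_sylvester; have := sum_b; lra.
Qed.

Lemma apex_weight_eq : b0 = (sylv_prod k)%:R^-1 ->
  forall i, (i < k)%N -> b i = (sylvester i.+1)%:R^-1.
Proof.
move=> b0E; apply: (sum_eq_sylvester b_gt0 b_nincr prefix_prod_le).
by rewrite sum_inv_sylvester -b0E; have := sum_b; lra.
Qed.

(** The other weights are now reciprocals of Sylvester numbers, whose product is exactly [b0]: the
    tight case. *)
Lemma apex_weight_eq_int (z : 'rV[R]_k) : b0 = (sylv_prod k)%:R^-1 ->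
  z *m v \is a mxOver Num.int -> z \is a mxOver Num.int.
Proof.
move=> b0E; apply: tight_coord_int; rewrite b0E -prod_inv_sylvester.
by under [leRHS]eq_bigr => i _ do rewrite apex_weight_eq //.
Qed.
End LatticeSimplex.

(** * Nonnegative combinations of prescribed total weight *)

Section WeightedHull.
Local Open Scope ring_scope.
Variables (R : realFieldType) (n d : nat) (W : 'M[R]_(n, d)).

(* Nonnegative combinations of the rows of [W] of total weight [s]; the convex
   hull is the case [s = 1]. *)
Definition wcone (s : R) (x : 'rV[R]_d) : Prop :=
  exists a : 'rV[R]_n, [/\ forall i, 0 <= a 0 i, \sum_i a 0 i = s & x = a *m W].

Lemma wcone0 : wcone 0 0.
Proof.
exists 0; split; [by move=> i; rewrite mxE| |by rewrite mul0mx].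
by rewrite big1 // => i _; rewrite mxE.
Qed.

Lemma wconeD s t x y : wcone s x -> wcone t y -> wcone (s + t) (x + y).
Proof.
move=> [a [a_ge0 <- ->]] [b [b_ge0 <- ->]]; exists (a + b); split.
- by move=> i; rewrite mxE addr_ge0.
- by rewrite -big_split; apply: eq_bigr => i _; rewrite mxE.
- by rewrite mulmxDl.
Qed.

Lemma wconeZ c s x : 0 <= c -> wcone s x -> wcone (c * s) (c *: x).
Proof.
move=> c_ge0 [a [a_ge0 <- ->]]; exists (c *: a); split.
- by move=> i; rewrite mxE mulr_ge0.
- by rewrite mulr_sumr; apply: eq_bigr => i _; rewrite mxE.
- by rewrite scalemxAl.
Qed.

Lemma wcone_sum (I : finType) (s : I -> R) (x : I -> 'rV[R]_d) :
  (forall i, wcone (s i) (x i)) -> wcone (\sum_i s i) (\sum_i x i).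
Proof. by move=> ?; elim/big_ind2: _ => [|????|? _]; [exact: wcone0|exact: wconeD|]. Qed.

Lemma wcone_row i : wcone 1 (row i W).
Proof.
exists (delta_mx 0 i); split; last by rewrite rowE.
- by move=> l; rewrite mxE ler0n.
- rewrite (bigD1 i) //= mxE !eqxx big1 ?addr0 // => l /negPf li.
  by rewrite mxE li andbF.
Qed.

Lemma wcone_comb k (v : 'M[R]_(k, d)) (a : 'rV[R]_k) :
  (forall i, wcone 1 (row i v)) -> (forall i, 0 <= a 0 i) ->
  wcone (\sum_i a 0 i) (a *m v).
Proof.
move=> v_in a_ge0; rewrite mulmx_sum_row; apply: wcone_sum => i.
by rewrite -[s in wcone s]mulr1; apply: wconeZ.
Qed.

End WeightedHull.

(** * Maximal weight of a vertex in a representation of the origin *)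

Section Optimum.
Local Open Scope ring_scope.
Variables (R : realFieldType) (n d : nat) (W : 'M[R]_(n, d)).
Implicit Types a b : 'rV[R]_n.

Definition feasible b : Prop :=
  [/\ forall i, 0 <= b 0 i, \sum_i b 0 i = 1 & b *m W = 0].

Definition supp b : {set 'I_n} := [set i | b 0 i != 0].

Definition affinely_free (A : {set 'I_n}) : Prop := forall a,
  (forall i, i \notin A -> a 0 i = 0) -> \sum_i a 0 i = 0 -> a *m W = 0 -> a = 0.

Lemma notin_supp b i : i \notin supp b -> b 0 i = 0.
Proof. by rewrite inE negbK => /eqP. Qed.

(** Caratheodory reduction: moving along an affine dependence of the support, oriented so that the
    coordinate [i0] does not decrease, until some coordinate vanishes. *)
Lemma free_support_above i0 b : feasible b ->
  exists b', [/\ feasible b', affinely_free (supp b') & b 0 i0 <= b' 0 i0].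
Proof.
have [m] := ubnP #|supp b|; elim: m b => // m IHm b; rewrite ltnS => card_b.
move=> [b_ge0 sum_b bW]; have [|nfree] := pselect (affinely_free (supp b)).
  by exists b.
have [a [a_supp sum_a aW a_neq0 a_i0]] : exists a,
    [/\ forall i, i \notin supp b -> a 0 i = 0, \sum_i a 0 i = 0, a *m W = 0,
        a != 0 & 0 <= a 0 i0].
  have [a [a_supp [sum_a [aW a_neq0]]]] : exists a,
      (forall i, i \notin supp b -> a 0 i = 0) /\ \sum_i a 0 i = 0 /\ a *m W = 0 /\ a != 0.
    apply: contrapT => no_a; apply: nfree => a a_supp sum_a aW.
    by apply/eqP/negPn/negP => a_neq0; apply: no_a; exists a.
  have [a_ge0|a_lt0] := lerP 0 (a 0 i0); first by exists a.
  exists (- a); split; rewrite ?oppr_eq0 // ?mulNmx ?aW ?oppr0 //.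
  - by move=> i /a_supp ai; rewrite mxE ai oppr0.
  - by rewrite (eq_bigr (fun i => - a 0 i)) ?sumrN ?sum_a ?oppr0 // => i _; rewrite mxE.
  - by rewrite mxE oppr_ge0 ltW.
have [l al_lt0] : exists l, a 0 l < 0.
  apply: contrapT => /forallNP a_ge0; move/eqP: a_neq0; apply.
  apply/rowP => i; rewrite mxE; apply: (psumr_eq0P _ sum_a) => // l _.
  by rewrite leNgt; apply/negP/a_ge0.
(* The smallest ratio is the largest step keeping all coordinates nonnegative. *)
pose ratio i := b 0 i / - a 0 i.
have [i1 ai1 min_i1] : exists2 i1, a 0 i1 < 0 &
    forall i, a 0 i < 0 -> ratio i1 <= ratio i.
  by case: (@arg_minP _ _ _ l (fun i => a 0 i < 0) ratio al_lt0) => i1 ? ?; exists i1.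
pose t := ratio i1.
have t_ge0 : 0 <= t by rewrite divr_ge0 // oppr_ge0 ltW.
have b'i1 : b 0 i1 + t * a 0 i1 = 0.
  by rewrite /t /ratio invrN mulrN mulNr divfK ?subrr // lt_eqF.
have [||b'' [fb'' free_b'' le_b'']] := IHm (b + t *: a); last first.
- exists b''; split=> //; apply: le_trans le_b''.
  by rewrite !mxE lerDl mulr_ge0.
- split.
  + move=> i; rewrite !mxE; have [ai_ge0|ai_lt0] := lerP 0 (a 0 i).
      by apply: addr_ge0 => //; apply: mulr_ge0.
    have := min_i1 i ai_lt0; rewrite -/t ler_pdivlMr ?oppr_gt0 //; lra.
  + rewrite (eq_bigr (fun i => b 0 i + t * a 0 i)); last by move=> i _; rewrite !mxE.
    by rewrite big_split /= -mulr_sumr sum_a mulr0 addr0.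
  + by rewrite mulmxDl bW -scalemxAl aW scaler0 addr0.
- apply: (leq_trans _ card_b); apply: proper_card; apply/properP; split.
    apply/subsetP => i; rewrite !inE; apply: contra => /eqP bi.
    by rewrite !mxE bi a_supp ?mulr0 ?addr0 // inE bi eqxx.
  exists i1; last by rewrite inE !mxE b'i1 eqxx.
  by apply: contraTT ai1 => /a_supp ->; rewrite ltxx.
Qed.

Lemma feasible_inj b b' : feasible b -> feasible b' ->
  affinely_free (supp b) -> supp b' = supp b -> b' = b.
Proof.
move=> [_ sum_b bW] [_ sum_b' b'W] free_b supp_eq; apply/eqP; rewrite -subr_eq0.
apply/eqP; apply: free_b.
- by move=> i ib; rewrite !mxE !notin_supp ?subrr // supp_eq.
- rewrite (eq_bigr (fun i => b' 0 i - b 0 i)); last by move=> i _; rewrite !mxE.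
  by rewrite sumrB sum_b sum_b' subrr.
- by rewrite mulmxBl bW b'W subrr.
Qed.

(* There are finitely many supports, and an affinely free support determines
   its feasible point. *)
Lemma feasible_maximum i0 : (exists b, feasible b) ->
  exists b, [/\ feasible b, affinely_free (supp b) &
    forall b', feasible b' -> b' 0 i0 <= b 0 i0].
Proof.
move=> [b0 fb0].
pose P (A : {set 'I_n}) b := [/\ feasible b, affinely_free (supp b) & supp b = A].
(* A feasible point is chosen for each support, with the junk value 0 where there is none; the
   maximum below ranges over the other supports only. *)
have [f fP] : {f & forall A, (exists b, P A b) -> P A (f A)}.
  apply: (@boolp.choice _ _ (fun A b => (exists b, P A b) -> P A b)) => A.
  have [[b Pb]|] := pselect (exists b, P A b); first by exists b.
  by exists 0.
have [b1 [fb1 free_b1 _]] := free_support_above i0 fb0.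
have Pb1 : `[< exists b, P (supp b1) b >] by apply/asboolP; exists b1.
have [A /asboolP/fP[fA free_A _] max_A] :=
  @arg_maxP _ _ _ (supp b1) (fun A => `[< exists b, P A b >]) (fun A => f A 0 i0) Pb1.
exists (f A); split=> // b' /(free_support_above i0)[b'' [fb'' free_b'' /le_trans]].
apply; have ex_b'' : `[< exists b, P (supp b'') b >] by apply/asboolP; exists b''.
have := max_A _ ex_b''; suff -> : f (supp b'') = b'' by [].
by have [? ? ?] := fP _ (ex_intro (P (supp b'')) b'' (And3 fb'' free_b'' erefl));
  apply: feasible_inj.
Qed.

End Optimum.

(** * Asymmetry of a hull around the origin in terms of optimal weights *)

Section AbsorbingHull.
Local Open Scope ring_scope.

(** Used for perturbations: positive weights stay nonnegative after a small change. *)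
Lemma small_scale (R : realFieldType) (I : finType) (f g : I -> R) :
  (forall i, 0 < f i) -> exists2 e, 0 < e & forall i, e * g i <= f i.
Proof.
move=> f_gt0; pose m := 1 + \sum_i `|g i| / f i.
have m_gt0 : 0 < m by rewrite ltr_pwDl // sumr_ge0 // => i _; rewrite divr_ge0 // ltW.
exists m^-1 => [|i]; first by rewrite invr_gt0.
rewrite mulrC ler_pdivrMr // (le_trans (ler_norm _)) // mulrC -ler_pdivrMr //.
rewrite /m (bigD1 i) //= addrCA lerDl addr_ge0 // sumr_ge0 // => l _.
by rewrite divr_ge0 // ltW.
Qed.

Variables (R : realFieldType) (n d : nat) (W : 'M[R]_(n, d)).
Hypotheses (d_gt0 : (0 < d)%N)
  (absorbing : forall x, exists2 e, 0 < e & wcone W 1 (e *: x)).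

Lemma wcone_origin s : 0 <= s -> wcone W s 0.
Proof.
move=> s_ge0; have [e _] := absorbing 0; rewrite scaler0.
by move/(wconeZ s_ge0); rewrite mulr1 scaler0.
Qed.

Lemma wcone_le s t x : s <= t -> wcone W s x -> wcone W t x.
Proof.
move=> st Wx; rewrite -[t](subrKC s) -[x]addr0.
by apply: wconeD => //; apply: wcone_origin; rewrite subr_ge0.
Qed.

Lemma wcone_weight0 x : wcone W 0 x -> x = 0.
Proof.
move=> [a [a_ge0 sum_a ->]]; suff -> : a = 0 by rewrite mul0mx.
by apply/rowP => i; rewrite mxE; apply: (psumr_eq0P _ sum_a).
Qed.

(** Moving the term of row [i] to the other side of the representation of the origin. *)
Lemma feasible_opp_row b i : feasible W b ->
  wcone W (1 - b 0 i) (- b 0 i *: row i W).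
Proof.
move=> [b_ge0 sum_b bW]; exists (b - b 0 i *: delta_mx 0 i); split.
- move=> l; rewrite !mxE /=; case: eqP => [->|_]; first by rewrite mulr1 subrr.
  by rewrite mulr0 subr0.
- rewrite -sum_b (bigD1 i) //= [in RHS](bigD1 i) //= !mxE !eqxx mulr1 subrr add0r.
  rewrite [RHS]addrC addKr; apply: eq_bigr => l /negPf li.
  by rewrite !mxE li mulr0 subr0.
- by rewrite mulmxBl bW sub0r -scalemxAl -rowE scaleNr.
Qed.

(** Adding weight [t] on row [i] represents the origin with total weight [1 + t]; it remains to
    normalize. *)
Lemma opp_row_feasible t i : 0 <= t -> wcone W 1 (- t *: row i W) ->
  exists2 b, feasible W b & t / (1 + t) <= b 0 i.
Proof.
move=> t_ge0 [a [a_ge0 sum_a aW]]; have t1 : 0 < 1 + t by rewrite ltr_pwDl.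
exists ((1 + t)^-1 *: (a + t *: delta_mx 0 i)); last first.
  by rewrite !mxE !eqxx mulr1 mulrC ler_pM2l ?invr_gt0 // lerDr.
split.
- move=> l; rewrite !mxE; apply: mulr_ge0; first by rewrite invr_ge0 ltW.
  by apply: addr_ge0 => //; apply: mulr_ge0 => //; rewrite ler0n.
- rewrite (eq_bigr (fun l => (1 + t)^-1 * (a 0 l + t * (l == i)%:R))).
    rewrite -mulr_sumr big_split /= sum_a -mulr_sumr (bigD1 i) //= eqxx big1.
      by rewrite addr0 mulr1 mulVf // gt_eqF.
    by move=> l /negPf ->.
  by move=> l _; rewrite !mxE.
- by rewrite -scalemxAl mulmxDl -aW -scalemxAl -rowE scaleNr addNr scaler0.
Qed.

(** Each row has a maximal weight; [i0] is a row for which this maximum is smallest. *)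
Lemma best_vertex : exists i0 b, [/\ feasible W b, affinely_free W (supp b),
  forall b', feasible W b' -> b' 0 i0 <= b 0 i0 &
  forall i, exists2 b', feasible W b' & b 0 i0 <= b' 0 i].
Proof.
have ex_b : exists b, feasible W b.
  by have [a [? ? /esym ?]] := wcone_origin ler01; exists a.
have n_gt0 : (0 < n)%N.
  rewrite lt0n; apply/eqP => n0; have [b [_ + _]] := ex_b.
  by rewrite big1 => [/esym/eqP|i _]; [rewrite oner_eq0|exfalso; move: i; rewrite n0 => -[]].
pose P i b := [/\ feasible W b, affinely_free W (supp b) &
  forall b', feasible W b' -> b' 0 i <= b 0 i].
have [f fP] := @boolp.choice _ _ P (fun i => feasible_maximum i ex_b).
have [i0 _ min_i0] := @arg_minP _ _ _ (Ordinal n_gt0) xpredT (fun i => f i 0 i) isT.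
have [? ? ?] := fP i0; exists i0, (f i0); split=> // i.
by exists (f i); [have [] := fP i|exact: min_i0].
Qed.

Variables (i0 : 'I_n) (b : 'rV[R]_n).
Hypotheses (b_feas : feasible W b) (b_free : affinely_free W (supp b))
  (b_max : forall b', feasible W b' -> b' 0 i0 <= b 0 i0)
  (b_min : forall i, exists2 b', feasible W b' & b 0 i0 <= b' 0 i).
Let M := b 0 i0.

Lemma best_weight_gt0 : 0 < M.
Proof.
have [e e_gt0] := absorbing (- row i0 W); rewrite scalerN -scaleNr.
case/(opp_row_feasible (ltW e_gt0)) => b' /b_max b'_le le_b'.
by apply: lt_le_trans b'_le; apply: lt_le_trans le_b'; rewrite divr_gt0 // addr_gt0.
Qed.

(** Row [i] admits a weight [b' 0 i] of at least [M]. Scaling by [M / b' 0 i] leaves a total of at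
    most [1 - M], and the origin absorbs the missing weight. *)
Lemma wcone_opp_row i : wcone W (1 - M) (- M *: row i W).
Proof.
have M_gt0 := best_weight_gt0; have [b' fb' le_M] := b_min i.
have b'_gt0 : 0 < b' 0 i := lt_le_trans M_gt0 le_M.
have c_ge0 : 0 <= M / b' 0 i by rewrite divr_ge0 // ltW.
have := wconeZ c_ge0 (feasible_opp_row i fb').
rewrite scalerA mulrN divfK ?gt_eqF //; apply: wcone_le.
by rewrite mulrBr mulr1 divfK ?gt_eqF // lerB // ler_pdivrMr // mul1r.
Qed.

(** If [M] were 1, all rows would vanish, which contradicts absorption in positive dimension. *)
Lemma best_weight_lt1 : M < 1.
Proof.
rewrite ltNge; apply/negP => M_ge1.
have M1 : M = 1.
  apply/eqP; rewrite eq_le M_ge1 andbT; have [b_ge0 <- _] := b_feas.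
  by rewrite (bigD1 i0) //= lerDl sumr_ge0.
have row0 i : row i W = 0.
  have := wcone_opp_row i; rewrite M1 subrr scaleN1r => /wcone_weight0/eqP.
  by rewrite oppr_eq0 => /eqP.
have [e e_gt0 [a [_ _]]] := absorbing (const_mx 1).
rewrite mulmx_sum_row big1 => [|i _]; last by rewrite row0 scaler0.
move/rowP/(_ (Ordinal d_gt0)); rewrite !mxE mulr1 => e0.
by rewrite e0 ltxx in e_gt0.
Qed.

Let mu := M / (1 - M).

Lemma best_ratio_gt0 : 0 < mu.
Proof. by rewrite divr_gt0 ?best_weight_gt0 // subr_gt0 best_weight_lt1. Qed.

(** The hull contains its own reflection scaled by [mu], so no chord through the origin has ratio
    above [mu^-1]. *)
Lemma wcone_opp x : wcone W 1 x -> wcone W 1 (- mu *: x).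
Proof.
have M1 : 0 < 1 - M by rewrite subr_gt0 best_weight_lt1.
move=> [a [a_ge0 sum_a ->]].
suff : wcone W (1 - M) (- M *: (a *m W)).
  move/(wconeZ (_ : 0 <= (1 - M)^-1)); rewrite invr_ge0 => /(_ (ltW M1)).
  by rewrite mulVf ?gt_eqF // scalerA mulrN [_ * M]mulrC.
have -> : 1 - M = \sum_i a 0 i * (1 - M) by rewrite -mulr_suml sum_a mul1r.
rewrite mulmx_sum_row scaler_sumr.
apply: wcone_sum => i; rewrite scalerA [- M * _]mulrC -scalerA.
by apply: wconeZ => //; apply: wcone_opp_row.
Qed.

(** A chord from the apex with parameter [t] gives the apex a weight of at least [t / (1 + t)],
    which cannot exceed [M]. *)
Lemma best_ratio_max t : 0 <= t -> wcone W 1 (- t *: row i0 W) -> t <= mu.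
Proof.
move=> t_ge0 /(opp_row_feasible t_ge0)[b' /b_max b'_le /le_trans/(_ b'_le)].
have M1 : 0 < 1 - M by rewrite subr_gt0 best_weight_lt1.
rewrite ler_pdivrMr ?ltr_pwDl // ler_pdivlMr //; rewrite -/M; lra.
Qed.

(** The vertices are the support of [b] without [i0], sorted by decreasing weight; affine freeness
    is that of the support. *)
Lemma best_simplex : exists k (v : 'M[R]_(k, d)) (c : nat -> R),
  [/\ forall i, exists l, row i v = row l W,
      forall i, (i < k)%N -> 0 < c i,
      \sum_(i < k) c i + M = 1 /\ (\row_i c i) *m v + M *: row i0 W = 0,
      forall (a : 'rV[R]_k) a0, \sum_i a 0 i + a0 = 0 ->
        a *m v + a0 *: row i0 W = 0 -> a = 0 /\ a0 = 0 &
      forall i, (i.+1 < k)%N -> c i.+1 <= c i].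
Proof.
have [b_ge0 sum_b bW] := b_feas; have M_gt0 := best_weight_gt0.
pose s := sort (fun i l => b 0 l <= b 0 i) (enum (supp b :\ i0)).
have mem_s l : (l \in s) = (l != i0) && (b 0 l != 0).
  by rewrite mem_sort mem_enum !inE.
have uniq_s : uniq s by rewrite sort_uniq enum_uniq.
pose k := size s; pose f (i : 'I_k) := nth i0 s i.
have f_s i : f i \in s by apply: mem_nth.
have f_inj : injective f.
  by move=> i l /eqP; rewrite /f nth_uniq // => /eqP/val_inj.
have f_surj l : l \in s -> exists i, l = f i.
  move=> ls; have il : (index l s < k)%N by rewrite index_mem.
  by exists (Ordinal il); rewrite /f nth_index.
pose E : 'M[R]_(k, n) := rowsub f 1%:M.
(* Weights on the simplex become weights on all rows, extended by zero. *)
pose emb (a : 'rV[R]_k) a0 := a *m E + a0 *: delta_mx 0 i0.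
have embE a a0 l : emb a a0 0 l = (a *m E) 0 l + a0 * (l == i0)%:R.
  by rewrite [LHS]mxE; congr (_ + _); rewrite !mxE.
have embW a a0 : emb a a0 *m W = a *m rowsub f W + a0 *: row i0 W.
  by rewrite mulmxDl -mulmxA -rowsubE -scalemxAl -rowE.
have aE_f (a : 'rV[R]_k) i : (a *m E) 0 (f i) = a 0 i.
  rewrite mxE (bigD1 i) //= !mxE eqxx mulr1 big1 ?addr0 // => l /negPf li.
  by rewrite !mxE (inj_eq f_inj) li mulr0.
have aE_notin (a : 'rV[R]_k) l : l \notin s -> (a *m E) 0 l = 0.
  move=> ls; rewrite mxE big1 // => i _; rewrite !mxE.
  by case: eqP => [fl|]; rewrite ?mulr0 //; rewrite -fl f_s in ls.
have i0_s : i0 \notin s by rewrite mem_s eqxx.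
have f_i0 i : (f i == i0) = false.
  by apply/negbTE; apply: contraNneq i0_s => <-.
have sum_emb a a0 : \sum_l emb a a0 0 l = \sum_i a 0 i + a0.
  have sumE m (x : 'rV[R]_m) : \sum_l x 0 l = (x *m const_mx 1 : 'M_1) 0 0.
    by rewrite mxE; apply: eq_bigr => l _; rewrite mxE mulr1.
  rewrite (sumE _ (emb a a0)) /emb mulmxDl -mulmxA -rowsubE -scalemxAl -rowE mxE [in RHS]sumE.
  congr (_ + _); last by rewrite !mxE mulr1.
  by congr ((_ *m _) 0 0); apply/matrixP => i l; rewrite !mxE.
pose c i := b 0 (nth i0 s i).
have bE : b = emb (\row_i c i) M.
  apply/rowP => l; rewrite embE.
  have [->|l_i0] := eqVneq l i0; first by rewrite aE_notin // mulr1 add0r.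
  rewrite mulr0 addr0; case: (boolP (l \in s)) => [/f_surj[i ->]|ls].
    by rewrite aE_f mxE.
  by rewrite aE_notin //; apply/eqP; move: ls; rewrite mem_s l_i0 negbK.
exists k, (rowsub f W), c; split.
- by move=> i; exists (f i); rewrite row_rowsub.
- move=> i ik; rewrite lt0r b_ge0 andbT.
  by have := mem_nth i0 ik; rewrite mem_s => /andP[].
- split; last by rewrite -embW -bE.
  rewrite -sum_b [in RHS]bE sum_emb; congr (_ + _).
  by apply: eq_bigr => i _; rewrite mxE.
- move=> a a0; rewrite -sum_emb -embW => sum0 emb0.
  have /rowP ab0 : emb a a0 = 0.
    apply: b_free => // l; rewrite inE negbK => bl.
    have l_i0 : (l == i0) = false by apply: contraTF bl => /eqP ->; rewrite gt_eqF.
    by rewrite embE aE_notin ?mem_s ?bl ?andbF // l_i0 mulr0 addr0.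
  split.
    apply/rowP => i; have := ab0 (f i).
    by rewrite embE aE_f f_i0 mulr0 addr0 => ->; rewrite !mxE.
  by have := ab0 i0; rewrite embE aE_notin // eqxx mulr1 add0r mxE.
- move=> i; have : sorted (fun i l => b 0 l <= b 0 i) s.
    by apply: sort_sorted => x y; apply: le_total.
  by move=> /(sortedP i0); apply.
Qed.

End AbsorbingHull.

(** * Coordinates of the extremal simplex *)

Section SylvesterCoordinates.
Local Open Scope ring_scope.
Variable R : archiRealFieldType.

Lemma dvdn_sylv_prod i k : (i < k)%N -> (sylvester i.+1 %| sylv_prod k)%N.
Proof. by move=> ik; rewrite sylv_prodE (bigD1 (Ordinal ik)) //= dvdn_mulr. Qed.

(** Modulo [sylvester i.+1], the earlier Sylvester numbers multiply to -1 and every later one is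
    1. *)
Lemma dvdn_sylv_coprod i k : (i < k)%N ->
  (sylvester i.+1 %| (\prod_(l < k | l != i :> nat) sylvester l.+1).+1)%N.
Proof.
elim: k => // k IHk; rewrite ltnS leq_eqVlt big_mkcond big_ord_recr /= -big_mkcond /=.
case/predU1P=> [->|ik].
  rewrite eqxx muln1 (eq_bigl xpredT) => [|l]; last by rewrite neq_ltn ltn_ord.
  by rewrite -sylv_prodE sylvesterE.
rewrite neq_ltn ik orbT [sylvester k.+1]sylvesterE mulnS -addSn dvdn_add ?IHk //.
by rewrite dvdn_mull // dvdn_sylv_prod.
Qed.

(* For [x = sum_i z_i v_i], where the origin has the weights [1/s_i] at the
   vertices [v_i], this is [s_i] times the barycentric coordinate of [x] at
   [v_i]. *)
Definition sylv_coord k (z : 'rV[R]_k) (i : 'I_k) : R :=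
  1 + (sylvester i.+1)%:R * z 0 i - \sum_l z 0 l.

(** With [p i = s i * z 0 i - sg], the relation [\sum_i (s i)^-1 = 1 - 1 / sylv_prod k] gives
    [sg = \sum_i q i * p i]. Then [z 0 i = (p i + sg) / s i] is an integer because [s i] divides
    [q i + 1] and every [q l] with [l != i]. *)
Lemma sylv_coord_int k (z : 'rV[R]_k) :
  (forall i, sylv_coord z i \is a Num.int) <-> z \is a mxOver Num.int.
Proof.
split=> [p_int|/mxOverP z_int i]; last first.
  by rewrite rpredB ?rpred_sum // rpredD ?rpred1 // rpredM ?rpred_nat.
pose s (i : 'I_k) : R := (sylvester i.+1)%:R.
pose q (i : 'I_k) := (\prod_(l < k | l != i :> nat) sylvester l.+1)%N.
have s_neq0 i : s i != 0 by rewrite gt_eqF ?sylvester_gt0.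
have N_gt0 : 0 < (sylv_prod k)%:R :> R by rewrite ltr0n sylv_prod_gt0.
have sq i : (sylv_prod k)%:R = s i * (q i)%:R.
  by rewrite sylv_prodE (bigD1 i) //= natrM; congr (_ * _%:R); apply: eq_bigl => l.
pose p i := sylv_coord z i - 1; pose sg := \sum_l z 0 l.
have {}p_int i : p i \is a Num.int by rewrite rpredB ?rpred1.
have zE i : z 0 i = (s i)^-1 * (p i + sg).
  by rewrite /p /sylv_coord -/(s i) -/sg; field; apply: s_neq0.
have sgE : sg = \sum_i (q i)%:R * p i.
  have : sg = \sum_i (s i)^-1 * p i + (1 - (sylv_prod k)%:R^-1) * sg.
    rewrite -sum_inv_sylvester mulr_suml -big_split; apply: eq_bigr => i _.
    by rewrite /= -mulrDr -zE.
  have -> : \sum_i (q i)%:R * p i = (sylv_prod k)%:R * \sum_i (s i)^-1 * p i.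
    by rewrite mulr_sumr; apply: eq_bigr => i _; rewrite (sq i) mulrCA mulrA mulKf.
  move: (\sum_i _) => t sg_eq; have -> : t = sg / (sylv_prod k)%:R by lra.
  by rewrite mulrC divfK // gt_eqF.
apply/mxOverP => i0 i; rewrite [i0]ord1 zE sgE (bigD1 i) //= addrA.
rewrite -[X in X + _ * _]mul1r -mulrDl mulrDr mulrA rpredD //.
  rewrite rpredM // nat1r; have /dvdnP[m ->] := dvdn_sylv_coprod (ltn_ord i).
  by rewrite natrM mulrC mulfK ?s_neq0 // rpred_nat.
rewrite mulr_sumr rpred_sum // => l /negPf li; rewrite mulrA rpredM //.
rewrite /q (bigD1 i) //=; last by rewrite eq_sym; apply/negbT.
by rewrite natrM mulKf ?s_neq0 // rpred_nat.
Qed.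

Lemma sylv_coord_inj k (z z' : 'rV[R]_k) :
  (forall i, sylv_coord z i = sylv_coord z' i) -> z = z'.
Proof.
move=> eq_coord; pose t := \sum_l z 0 l - \sum_l z' 0 l.
have dE i : z 0 i - z' 0 i = (sylvester i.+1)%:R^-1 * t.
  have s_neq0 : (sylvester i.+1)%:R != 0 :> R by rewrite gt_eqF ?sylvester_gt0.
  apply: (mulfI s_neq0); rewrite mulVKf //.
  by have := eq_coord i; rewrite /sylv_coord /t; lra.
have t0 : t = 0.
  have : t = (1 - (sylv_prod k)%:R^-1) * t.
    rewrite -sum_inv_sylvester mulr_suml {1}/t -sumrB.
    by apply: eq_bigr => i _; rewrite dE.
  have : 0 < (sylv_prod k)%:R^-1 :> R by rewrite invr_gt0 ltr0n sylv_prod_gt0.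
  by move: _^-1 => u u_gt0 tE; apply: (mulfI (lt0r_neq0 u_gt0)); lra.
by apply/rowP => i; apply/eqP; rewrite -subr_eq0 dE t0 mulr0.
Qed.

Lemma sylv_coord_surj k (y : 'I_k -> R) : exists z, forall i, sylv_coord z i = y i.
Proof.
(* The sum [t] of the sought vector must satisfy [t = w + (1 - 1 / sylv_prod k) * t]. *)
pose w := \sum_(i < k) (sylvester i.+1)%:R^-1 * (y i - 1).
pose t := (sylv_prod k)%:R * w.
exists (\row_i ((sylvester i.+1)%:R^-1 * (y i - 1 + t))) => i.
rewrite /sylv_coord; have -> : \sum_l (\row_i ((sylvester i.+1)%:R^-1 * (y i - 1 + t))) 0 l = t.
  under eq_bigr => l _ do rewrite mxE mulrDr.
  rewrite big_split /= -mulr_suml sum_inv_sylvester -/w /t.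
  by field; rewrite gt_eqF // ltr0n sylv_prod_gt0.
by rewrite mxE mulVKf ?gt_eqF ?sylvester_gt0 //; ring.
Qed.

End SylvesterCoordinates.

(** * Lattice polytopes with the origin as only interior lattice point *)

Section LatticePolytope.
Local Open Scope ring_scope.
Variables (R : archiRealFieldType) (n d : nat) (W : 'M[R]_(n, d)).
Hypotheses (d_gt0 : (0 < d)%N) (W_int : W \is a mxOver Num.int)
  (absorbing : forall x, exists2 e, 0 < e & wcone W 1 (e *: x))
  (only0 : forall x : 'rV[R]_d, x \is a mxOver Num.int ->
     (exists2 e, 0 < e & wcone W 1 ((1 + e) *: x)) -> x = 0).
Variables (i0 : 'I_n) (b : 'rV[R]_n).
Hypotheses (b_feas : feasible W b) (b_free : affinely_free W (supp b))
  (b_max : forall b', feasible W b' -> b' 0 i0 <= b 0 i0)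
  (b_min : forall i, exists2 b', feasible W b' & b 0 i0 <= b' 0 i).
Let M := b 0 i0.
Let v0 := row i0 W.
Let M_gt0 : 0 < M := best_weight_gt0 absorbing b_max.
Let M_lt1 : M < 1 := best_weight_lt1 d_gt0 absorbing b_feas b_max b_min.

(** * The inscribed simplex and the lower bound for the optimal weight *)

Section InscribedSimplex.
Variables (k : nat) (v : 'M[R]_(k, d)) (c : nat -> R).
Let cv : 'rV[R]_k := \row_i c i.
Hypotheses (v_row : forall i, exists l, row i v = row l W)
  (c_gt0 : forall i, (i < k)%N -> 0 < c i)
  (sum_c : \sum_(i < k) c i + M = 1) (comb_c : cv *m v + M *: v0 = 0)
  (v_free : forall (a : 'rV[R]_k) a0, \sum_i a 0 i + a0 = 0 ->
     a *m v + a0 *: v0 = 0 -> a = 0 /\ a0 = 0)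
  (c_nincr : forall i, (i.+1 < k)%N -> c i.+1 <= c i).

Lemma inscribed_int : v \is a mxOver Num.int.
Proof.
apply/mxOverP => i l; have [i' /rowP/(_ l)] := v_row i.
by rewrite !mxE => ->; apply/mxOverP.
Qed.

Lemma apex_int : v0 \is a mxOver Num.int.
Proof. by apply/mxOverP => i l; rewrite mxE; apply/mxOverP. Qed.

Lemma wcone_inscribed (a : 'rV[R]_k) a0 : (forall i, 0 <= a 0 i) -> 0 <= a0 ->
  wcone W (\sum_i a 0 i + a0) (a *m v + a0 *: v0).
Proof.
move=> a_ge0 a0_ge0; apply: wconeD.
  by apply: wcone_comb => // i; have [l ->] := v_row i; apply: wcone_row.
by rewrite -[a0 in wcone _ a0]mulr1; apply: wconeZ => //; apply: wcone_row.
Qed.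

Lemma sum_rowZ (x y : 'rV[R]_k) t : \sum_i (x + t *: y) 0 i = \sum_i x 0 i + t * \sum_i y 0 i.
Proof. by rewrite mulr_sumr -big_split; apply: eq_bigr => i _; rewrite !mxE. Qed.

Lemma sum_cv : \sum_i cv 0 i = 1 - M.
Proof. by rewrite -sum_c addrK; apply: eq_bigr => i _; rewrite mxE. Qed.

(** Subtracting [e] times the representation of the origin from [1 + e] times that of the point
    keeps the weights nonnegative for small [e]; so the point can be pushed outwards inside the
    hull. *)
Lemma inscribed_interior0 (a : 'rV[R]_k) a0 :
  (forall i, 0 < a 0 i) -> 0 < a0 -> \sum_i a 0 i + a0 = 1 ->
  a *m v + a0 *: v0 \is a mxOver Num.int -> a *m v + a0 *: v0 = 0.
Proof.
move=> a_gt0 a0_gt0 sum_a /only0; apply.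
pose f (o : option 'I_k) := if o is Some i then a 0 i else a0.
pose g (o : option 'I_k) := if o is Some i then c i - a 0 i else M - a0.
have [|e e_gt0 e_le] := @small_scale _ _ f g; first by case.
exists e => //; pose a' := (1 + e) *: a + (- e) *: cv.
have -> : (1 + e) *: (a *m v + a0 *: v0) = a' *m v + ((1 + e) * a0 - e * M) *: v0.
  rewrite -[LHS]subr0 -[X in _ - X](scaler0 _ e) -comb_c mulmxDl !scalerDr -!scalemxAl.
  by rewrite scalerBl !scalerA scaleNr opprD addrACA.
have sum_a' : \sum_i a' 0 i + ((1 + e) * a0 - e * M) = 1.
  rewrite sum_rowZ (eq_bigr (fun i => (1 + e) * a 0 i)) => [|i _]; last by rewrite mxE.
  rewrite -mulr_sumr sum_cv; have -> : \sum_i a 0 i = 1 - a0 by rewrite -sum_a addrK.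
  by ring.
rewrite -[X in wcone _ X _]sum_a'.
apply: wcone_inscribed => [i|]; last by have := e_le None; rewrite /=; lra.
by rewrite !mxE; have := e_le (Some i); rewrite /=; lra.
Qed.

Lemma inscribed_apex_ge : (sylv_prod k)%:R^-1 <= M.
Proof.
exact: apex_weight_ge inscribed_int apex_int c_gt0 M_gt0 sum_c comb_c v_free
  inscribed_interior0 c_nincr.
Qed.

(** A multiple of the representation of the origin corrects a linear dependence into an affine one;
    the positive apex weight makes that multiple zero. *)
Lemma inscribed_row_free : row_free v.
Proof.
apply: inj_row_free => z zv; pose sg := \sum_i z 0 i.
have [||] := @v_free (z + (- sg) *: cv) (- sg * M).
- by rewrite sum_rowZ sum_cv /sg; ring.
- by rewrite mulmxDl zv add0r -scalemxAl -scalerA -scalerDr comb_c scaler0.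
move=> + /eqP; rewrite mulf_eq0 (gt_eqF M_gt0) orbF oppr_eq0 => + /eqP sg0.
by rewrite sg0 oppr0 scale0r addr0.
Qed.

Lemma inscribed_dim : (0 < k <= d)%N.
Proof.
apply/andP; split; last by move/eqP: inscribed_row_free => <-; apply: rank_leq_col.
rewrite lt0n; apply/eqP => k0; move: sum_c; rewrite k0 big_ord0 add0r => M1.
by move: M_lt1; rewrite M1 ltxx.
Qed.

Lemma best_weight_ge_inscribed : (sylv_prod d)%:R^-1 <= M.
Proof.
apply: le_trans inscribed_apex_ge; have /andP[k_gt0] := inscribed_dim.
rewrite lef_pV2 ?posrE ?ltr0n ?sylv_prod_gt0 // ler_nat leq_eqVlt.
by case/predU1P=> [->//|/(ltn_sylv_prod k_gt0)/ltnW].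
Qed.

Lemma best_weight_eq_dim : M = (sylv_prod d)%:R^-1 -> k = d.
Proof.
move=> ME; have := inscribed_apex_ge; have /andP[k_gt0 kd] := inscribed_dim.
rewrite ME lef_pV2 ?posrE ?ltr0n ?sylv_prod_gt0 // ler_nat leqNgt.
by move: kd; rewrite leq_eqVlt => /predU1P[//|/(ltn_sylv_prod k_gt0) ->].
Qed.

End InscribedSimplex.

Lemma best_weight_ge : (sylv_prod d)%:R^-1 <= M.
Proof.
have [k [v [c [v_row c_gt0 [sum_c comb_c] v_free c_nincr]]]] :=
  best_simplex absorbing b_feas b_free b_max.
exact: best_weight_ge_inscribed v_row c_gt0 sum_c comb_c v_free c_nincr.
Qed.

(** * Equality case: the polytope is the inscribed simplex *)

Section Extremal.
Variables (v : 'M[R]_d) (c : nat -> R).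
Let cv : 'rV[R]_d := \row_i c i.
Hypotheses (v_row : forall i, exists l, row i v = row l W)
  (c_gt0 : forall i, (i < d)%N -> 0 < c i)
  (sum_c : \sum_(i < d) c i + M = 1) (comb_c : cv *m v + M *: v0 = 0)
  (v_free : forall (a : 'rV[R]_d) a0, \sum_i a 0 i + a0 = 0 ->
     a *m v + a0 *: v0 = 0 -> a = 0 /\ a0 = 0)
  (c_nincr : forall i, (i.+1 < d)%N -> c i.+1 <= c i)
  (ME : M = (sylv_prod d)%:R^-1).

Let v_int := inscribed_int v_row.

Let cE i : (i < d)%N -> c i = (sylvester i.+1)%:R^-1.
Proof.
exact (fun i_lt => apex_weight_eq v_int apex_int c_gt0 M_gt0 sum_c comb_c v_free
  (inscribed_interior0 v_row sum_c comb_c) c_nincr ME i_lt).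
Qed.

Let v_unit : v \in unitmx.
Proof. by rewrite -row_free_unit; apply: inscribed_row_free sum_c comb_c v_free. Qed.

Let cvE : cv *m v = - M *: v0.
Proof. by apply/eqP; rewrite scaleNr -addr_eq0 comb_c. Qed.

Lemma extremal_lattice (z : 'rV[R]_d) : z *m v \is a mxOver Num.int <->
  forall i, sylv_coord z i \is a Num.int.
Proof.
split=> [zv_int|/sylv_coord_int z_int]; last exact: mxOver_intM.
apply/sylv_coord_int; exact (apex_weight_eq_int v_int apex_int c_gt0 M_gt0 sum_c comb_c
  v_free (inscribed_interior0 v_row sum_c comb_c) c_nincr ME zv_int).
Qed.

(* A vertex beyond the facet opposite to the apex would lengthen the ray from
   the origin away from the apex. *)
Lemma extremal_apex_coord l (z : 'rV[R]_d) : row l W = z *m v -> \sum_i z 0 i <= 1.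
Proof.
move=> wE; rewrite leNgt; apply/negP; set sg := \sum_i z 0 i => sg_gt1.
have [|e e_gt0 e_le] := @small_scale _ 'I_d (fun i => c i) (fun i => z 0 i).
  by move=> i; apply: c_gt0.
(* [t] and [u] are dictated by the total weight [u * (1 - M) - e * sg + e], which has to be 1. *)
pose t := e * (sg - 1); have t_gt0 : 0 < t by rewrite mulr_gt0 // subr_gt0.
have M1 : 0 < 1 - M by rewrite subr_gt0.
pose u := (1 + t) / (1 - M).
have u_ge1 : 1 <= u by rewrite ler_pdivlMr // mul1r; have := M_gt0; lra.
have : (1 + t) * (M / (1 - M)) <= M / (1 - M).
  apply: (best_ratio_max d_gt0 absorbing b_feas b_max b_min).
    by rewrite mulr_ge0 ?divr_ge0 // ltW // addr_gt0.
  have -> : - ((1 + t) * (M / (1 - M))) *: v0 = (u *: cv + (- e) *: z) *m v + e *: row l W.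
    rewrite wE mulmxDl -!scalemxAl [- e *: _]scaleNr addrNK.
    by rewrite cvE scalerA /u; congr (_ *: _); rewrite /=; ring.
  have sum1 : \sum_i (u *: cv + (- e) *: z) 0 i + e * 1 = 1.
    rewrite sum_rowZ -/sg (eq_bigr (fun i => u * cv 0 i)) => [|i _]; last by rewrite mxE.
    rewrite -mulr_sumr (sum_cv sum_c) /u divfK ?gt_eqF // /t; ring.
  rewrite -[X in wcone _ X _]sum1; apply: wconeD; last by apply: wconeZ (ltW e_gt0) (wcone_row W l).
  apply: wcone_comb => [i|i]; first by have [l' ->] := v_row i; apply: wcone_row.
  rewrite !mxE; have := e_le i; have := c_gt0 (ltn_ord i); nra.
by rewrite ger_pMl ?divr_gt0 //; lra.
Qed.

(* In the coordinates of [simplexT], the lattice point [(1, ..., 1) - e_i] lies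
   in the relative interior of the facet [x_i = 0]; it would become interior. *)
Lemma extremal_facet_coord l (z : 'rV[R]_d) i : row l W = z *m v ->
  0 <= z 0 i + (1 - \sum_j z 0 j) * c i.
Proof.
move=> wE; set sg := \sum_j z 0 j.
(* Barycentric coordinates of row [l] with respect to the simplex. *)
pose xi j := z 0 j + (1 - sg) * c j; pose xi0 := (1 - sg) * M.
rewrite -/(xi i) leNgt; apply/negP => xi_lt0.
have ci_gt0 := c_gt0 (ltn_ord i).
pose f (o : option 'I_d) := if o is Some j then c j else M.
pose g (o : option 'I_d) := if o is Some j then xi j else xi0.
have [[j|]|e e_gt0 e_le] := @small_scale _ _ f g; [exact: c_gt0|exact: M_gt0|].
(* The facet point defined next, stretched by [1 + t], has coordinate [- t * c i] at vertex [i];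
   this is what weight [e] on row [l] contributes there. *)
pose t := - (e * xi i) / c i.
have t_gt0 : 0 < t by rewrite divr_gt0 // oppr_gt0 pmulr_rlt0.
(* [z' *m v] is [c i] times the apex minus vertex [i]: the whole weight of vertex [i] at the origin
   moves to the apex. *)
pose z' : 'rV[R]_d := - (c i / M) *: cv + (- c i) *: delta_mx 0 i.
have sum_delta : \sum_j (delta_mx 0 i : 'rV[R]_d) 0 j = 1.
  rewrite (bigD1 i) //= mxE !eqxx big1 ?addr0 // => j /negPf ji.
  by rewrite mxE ji andbF.
have sum_z' : \sum_j z' 0 j = - (c i / M).
  rewrite sum_rowZ sum_delta (eq_bigr (fun j => - (c i / M) * cv 0 j)) => [|j _].
    by rewrite -mulr_sumr (sum_cv sum_c); field; rewrite gt_eqF.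
  by rewrite mxE.
have coord_z' j : sylv_coord z' j = 1 - (j == i)%:R.
  rewrite /sylv_coord sum_z' !mxE eqxx /= (cE (ltn_ord j)).
  have s_neq0 : (sylvester j.+1)%:R != 0 :> R by rewrite gt_eqF ?sylvester_gt0.
  have [->|_] := eqVneq j i; last by rewrite /=; field; rewrite s_neq0 gt_eqF.
  by rewrite (cE (ltn_ord i)) /=; field; rewrite ?s_neq0 ?gt_eqF ?sylvester_gt0.
have z'v : z' *m v = (cv + (- c i) *: delta_mx 0 i) *m v + (M + c i) *: v0.
  rewrite !mulmxDl addrAC [(M + _) *: _]scalerDl [X in _ = X + _]addrA comb_c add0r.
  by congr (_ + _); rewrite -scalemxAl cvE scalerA mulrN mulNr opprK divfK // gt_eqF.
have z'v0 : z' *m v = 0.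
  apply: only0; first by apply/extremal_lattice => j; rewrite coord_z' rpredB ?rpred1 ?rpred_nat.
  exists t => //.
  pose a := (\row_j (c j - e * xi j) : 'rV[R]_d) + (- (c i - e * xi i)) *: delta_mx 0 i.
  have a_ge0 j : 0 <= a 0 j.
    rewrite !mxE eqxx /=; have [->|_] := eqVneq j i; first by rewrite /= mulr1 subrr.
    by rewrite /= mulr0 addr0 subr_ge0 (e_le (Some j)).
  pose a0 := M + (1 + t) * c i - e * xi0.
  have a0_ge0 : 0 <= a0.
    have := e_le None; rewrite /= /a0; have := mulr_gt0 t_gt0 ci_gt0; lra.
  have tc : t * c i = - (e * xi i) by rewrite divfK ?gt_eqF.
  have sum_xi : \sum_j xi j + xi0 = 1.
    rewrite big_split /= -mulr_sumr -/sg /xi0 -addrA -mulrDr sum_c; ring.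
  have wcomb : (\row_j xi j) *m v + xi0 *: v0 = row l W.
    have -> : \row_j xi j = z + (1 - sg) *: cv by apply/rowP => j; rewrite !mxE.
    by rewrite mulmxDl -scalemxAl -addrA /xi0 -scalerA -scalerDr comb_c scaler0 addr0 wE.
  have := wconeD (wconeZ (ltW e_gt0) (wcone_row W l)) (wcone_inscribed v_row a_ge0 a0_ge0).
  congr wcone.
    rewrite sum_rowZ sum_delta /a0 (eq_bigr (fun j : 'I_d => c j - e * xi j)) => [|j _].
      rewrite sumrB -mulr_sumr; have := sum_xi; have := sum_c; nra.
    by rewrite mxE.
  rewrite -wcomb z'v /a /a0.
  have -> : \row_j (c j - e * xi j) = cv + (- e) *: \row_j xi j.
    by apply/rowP => j; rewrite !mxE mulNr.
  have -> : - (c i - e * xi i) = (1 + t) * - c i by have := tc; lra.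
  rewrite !mulmxDl -!scalemxAl cvE.
  move: (delta_mx 0 i *m v) ((\row_j xi j) *m v) (v0) => B X V.
  by apply/rowP => h; rewrite !mxE; ring.
have := congr1 (fun x => sylv_coord x i) (row_free_inj (inscribed_row_free sum_c comb_c v_free)
  (etrans z'v0 (esym (mul0mx _ v)))).
rewrite coord_z' eqxx subrr /sylv_coord mxE mulr0 addr0 big1 => [|j _]; last by rewrite mxE.
by rewrite subr0 => /esym/eqP; rewrite oner_eq0.
Qed.

(** The inequalities known for the rows of [W], made homogeneous in the total weight, pass to
    nonnegative combinations. *)
Lemma extremal_wcone s (z : 'rV[R]_d) : wcone W s (z *m v) ->
  (forall i, 0 <= z 0 i + (s - \sum_j z 0 j) * c i) /\ \sum_j z 0 j <= s.
Proof.
move=> [a [a_ge0 <- zvE]]; pose Z := W *m invmx v.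
have ZE l : row l W = row l Z *m v by rewrite -row_mul mulmxKV.
have zE i : z 0 i = \sum_l a 0 l * row l Z 0 i.
  have -> : z = a *m Z by rewrite mulmxA -zvE mulmxK.
  by rewrite mxE; apply: eq_bigr => l _; rewrite [row l Z 0 i]mxE.
have sumz : \sum_j z 0 j = \sum_l a 0 l * \sum_j row l Z 0 j.
  under eq_bigr => j _ do rewrite zE.
  by rewrite exchange_big; apply: eq_bigr => l _; rewrite mulr_sumr.
split=> [i|].
  rewrite sumz zE -sumrB mulr_suml -big_split sumr_ge0 // => l _ /=.
  have := mulr_ge0 (a_ge0 l) (extremal_facet_coord i (ZE l)).
  by congr (0 <= _); ring.
rewrite sumz ler_sum // => l _; rewrite ler_piMr //.
exact: extremal_apex_coord (ZE l).
Qed.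

(** The two conditions express that the barycentric coordinates at the [v_i] and at the apex, the
    latter being [(1 - sg) * M], are nonnegative. *)
Lemma extremal_hull (z : 'rV[R]_d) : wcone W 1 (z *m v) <->
  (forall i, 0 <= sylv_coord z i) /\
  \sum_(i < d) (sylvester i.+1)%:R^-1 * sylv_coord z i <= 1.
Proof.
pose sg := \sum_j z 0 j; pose xi i := z 0 i + (1 - sg) * c i.
have coordE (i : 'I_d) : (sylvester i.+1)%:R^-1 * sylv_coord z i = xi i.
  rewrite /xi cE // /sylv_coord -/sg; field.
  by rewrite gt_eqF ?sylvester_gt0.
have coord_ge0 (i : 'I_d) : (0 <= sylv_coord z i) = (0 <= xi i).
  by rewrite -coordE pmulr_rge0 // invr_gt0 sylvester_gt0.
have sum_xi : \sum_(i < d) xi i = 1 - (1 - sg) * M.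
  rewrite big_split /= -mulr_sumr -/sg; have := sum_c; nra.
have sum_le : (\sum_(i < d) (sylvester i.+1)%:R^-1 * sylv_coord z i <= 1) = (sg <= 1).
  under eq_bigr => i _ do rewrite coordE.
  by rewrite sum_xi gerBl pmulr_lge0 // subr_ge0.
rewrite sum_le; split=> [/extremal_wcone[xi_ge0 sg_le]|[xi_ge0 sg_le]].
  by split=> // i; rewrite coord_ge0; apply: xi_ge0.
have := @wcone_inscribed _ v v_row (\row_i xi i) ((1 - sg) * M).
have -> : \row_(i < d) xi i = z + (1 - sg) *: cv by apply/rowP => i; rewrite !mxE.
rewrite mulmxDl -scalemxAl -addrA -scalerA -scalerDr comb_c scaler0 addr0.
rewrite sum_rowZ (sum_cv sum_c) -/sg.
have -> : sg + (1 - sg) * (1 - M) + (1 - sg) * M = 1 by ring.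
apply=> [i|]; last by rewrite mulr_ge0 ?subr_ge0 // ltW.
by rewrite !mxE -/(xi i) -coord_ge0.
Qed.

End Extremal.

Lemma extremal_coordinates : M = (sylv_prod d)%:R^-1 ->
  exists v : 'M[R]_d, [/\ v \in unitmx,
    forall z : 'rV[R]_d, z *m v \is a mxOver Num.int <->
      forall i, sylv_coord z i \is a Num.int &
    forall z : 'rV[R]_d, wcone W 1 (z *m v) <->
      (forall i, 0 <= sylv_coord z i) /\
      \sum_(i < d) (sylvester i.+1)%:R^-1 * sylv_coord z i <= 1].
Proof.
have [k [v [c [v_row c_gt0 [sum_c comb_c] v_free c_nincr]]]] :=
  best_simplex absorbing b_feas b_free b_max.
move=> ME; have kd := best_weight_eq_dim v_row c_gt0 sum_c comb_c v_free c_nincr ME.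
subst k; exists v; split.
- by rewrite -row_free_unit; apply: inscribed_row_free sum_c comb_c v_free.
- by move=> z; apply: extremal_lattice v_row c_gt0 sum_c comb_c v_free c_nincr ME z.
- by move=> z; apply: extremal_hull v_row c_gt0 sum_c comb_c v_free c_nincr ME z.
Qed.

End LatticePolytope.

(** * Vectors as row matrices *)

Section RealVectors.
Local Open Scope ring_scope.
Variable d : nat.
Implicit Types (x y : vec d) (r : 'rV[R]_d).

Definition vrow x : 'rV[R]_d := \row_i x i.

Definition rvec r : vec d := fun i => r 0 i.

Lemma vrowK : cancel vrow rvec.
Proof. by move=> x; apply/funext => i; rewrite /rvec mxE. Qed.

Lemma rvecK : cancel rvec vrow.
Proof. by move=> r; apply/rowP => i; rewrite mxE. Qed.

Lemma vrow_vzero : vrow (vzero d) = 0.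
Proof. by apply/rowP => i; rewrite !mxE. Qed.

Lemma vrow_vsub x y : vrow (vsub x y) = vrow x - vrow y.
Proof. by apply/rowP => i; rewrite !mxE. Qed.

Lemma vrow_vadd x y : vrow (vadd x y) = vrow x + vrow y.
Proof. by apply/rowP => i; rewrite !mxE. Qed.

Lemma vrow_vscale c x : vrow (vscale c x) = c *: vrow x.
Proof. by apply/rowP => i; rewrite !mxE. Qed.

Definition rnorm r : R := Num.sqrt (\sum_i r 0 i ^+ 2).

Lemma vnormE x : vnorm x = rnorm (vrow x).
Proof.
rewrite /vnorm RsqrtE /rnorm; congr Num.sqrt.
by apply: eq_bigr => i _; rewrite mxE expr2.
Qed.

Lemma rnorm_ge0 r : 0 <= rnorm r. Proof. exact: sqrtr_ge0. Qed.

Lemma rnormZ c r : rnorm (c *: r) = `|c| * rnorm r.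
Proof.
rewrite /rnorm -sqrtr_sqr -sqrtrM ?sqr_ge0 // mulr_sumr; congr Num.sqrt.
by apply: eq_bigr => i _; rewrite mxE exprMn.
Qed.

Lemma rnorm_gt0 r : r != 0 -> 0 < rnorm r.
Proof.
move=> r_neq0; rewrite lt0r rnorm_ge0 andbT; apply: contra r_neq0.
rewrite /rnorm sqrtr_eq0 => sum_le0; apply/eqP/rowP => i; rewrite mxE.
have sum0 : \sum_l r 0 l ^+ 2 = 0.
  by apply/eqP; rewrite eq_le sum_le0 sumr_ge0 // => l _; rewrite sqr_ge0.
apply/eqP; rewrite -sqrf_eq0; apply/eqP.
by apply: (psumr_eq0P _ sum0) => // l _; rewrite sqr_ge0.
Qed.

Lemma IZR_int (z : Z) : IZR z \is a Num.int.
Proof.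
case: z => [|p|p]; first exact: rpred0.
  by rewrite /IZR -INR_IPR INRE rpred_nat.
by rewrite /IZR -INR_IPR INRE RoppE rpredN rpred_nat.
Qed.

Lemma int_IZR (t : R) : t \is a Num.int -> exists z, t = IZR z.
Proof.
move=> /intrP[m ->]; case: m => m.
  by exists (Z.of_nat m); rewrite -INR_IZR_INZ INRE.
by exists (Z.opp (Z.of_nat m.+1)); rewrite opp_IZR -INR_IZR_INZ INRE NegzE rmorphN.
Qed.

Lemma latticeE x : lattice x <-> vrow x \is a mxOver Num.int.
Proof.
split=> [x_int|/mxOverP x_int i].
  by apply/mxOverP => i l; rewrite mxE; have [z ->] := x_int l; apply: IZR_int.
by apply: int_IZR; have := x_int 0 i; rewrite mxE.
Qed.

End RealVectors.

(** * Interior, closure and boundary of a hull by scaling *)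

Section HullTopology.
Local Open Scope ring_scope.
Variables (d : nat) (V : seq (vec d)).
Implicit Types (x y : vec d) (r : 'rV[R]_d).

Definition vertex_mx : 'M[R]_(size V, d) := \matrix_(i, l) nth (vzero d) V i l.
Let W := vertex_mx.

Lemma convE x : conv V x <-> wcone W 1 (vrow x).
Proof.
split=> [[lam [lam_ge0 [sum_lam xE]]]|[a [a_ge0 sum_a xE]]].
  exists (\row_i lam i); split=> [i||].
  - by rewrite mxE; apply/RleP.
  - by rewrite -[RHS]sum_lam; apply: eq_bigr => i _; rewrite mxE.
  - by apply/rowP => l; rewrite !mxE xE; apply: eq_bigr => i _; rewrite !mxE.
pose lam (k : nat) : R := if insub k is Some i then a 0 i else 0.
have lamE (i : 'I_(size V)) : lam i = a 0 i by rewrite /lam valK.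
exists lam; split=> [k|].
  by apply/RleP; rewrite /lam; case: insubP.
split; first by rewrite -[RHS]sum_a; apply: eq_bigr => i _; rewrite lamE.
move=> l; have /rowP/(_ l) := xE; rewrite !mxE => ->.
by apply: eq_bigr => i _; rewrite lamE !mxE.
Qed.

Hypothesis int0 : int_set (conv V) (vzero d).

Lemma hull_ball : exists2 eps, 0 < eps & forall r, rnorm r < eps -> wcone W 1 r.
Proof.
have [eps [/RltP eps_gt0 ball]] := int0; exists eps => // r r_lt.
rewrite -[r]rvecK; apply/convE/ball/RltP.
by rewrite vnormE vrow_vsub vrow_vzero subr0 rvecK.
Qed.

Lemma hull_absorbing r : exists2 e, 0 < e & wcone W 1 (e *: r).
Proof.
have [eps eps_gt0 ball] := hull_ball.
have r1 : 0 < 1 + rnorm r by rewrite ltr_pwDl ?rnorm_ge0.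
exists (eps / (1 + rnorm r)); first by rewrite divr_gt0.
apply: ball; rewrite rnormZ gtr0_norm ?divr_gt0 // mulrAC ltr_pdivrMr //.
by rewrite ltr_pM2l // ltrDr.
Qed.

Lemma int_convE x : int_set (conv V) x <->
  exists2 e, 0 < e & wcone W 1 ((1 + e) *: vrow x).
Proof.
split=> [[eps [/RltP eps_gt0 ball]]|[e e_gt0 xW]].
  have r1 : 0 < 1 + rnorm (vrow x) by rewrite ltr_pwDl ?rnorm_ge0.
  exists (eps / (1 + rnorm (vrow x))); first by rewrite divr_gt0.
  rewrite -[X in wcone _ _ X]rvecK; apply/convE/ball/RltP.
  rewrite vnormE vrow_vsub rvecK scalerDl scale1r addrAC subrr add0r.
  rewrite rnormZ gtr0_norm ?divr_gt0 // mulrAC ltr_pdivrMr //.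
  by rewrite ltr_pM2l // ltrDr.
have [eps eps_gt0 ball] := hull_ball; have e1 : 0 < 1 + e by rewrite addr_gt0.
exists (eps * e / (1 + e)); split; first by apply/RltP; rewrite divr_gt0 // mulr_gt0.
move=> y /RltP; rewrite vnormE vrow_vsub => y_lt; apply/convE.
(* [y] is a convex combination of [(1 + e) *: x] and the short vector [w]. *)
pose w := ((1 + e) / e) *: (vrow y - vrow x).
have wW : wcone W 1 w.
  apply: ball; rewrite rnormZ gtr0_norm ?divr_gt0 //.
  by rewrite mulrAC ltr_pdivrMr // mulrC -ltr_pdivlMr.
have c_ge0 : 0 <= (1 + e)^-1 by rewrite invr_ge0 ltW.
have c'_ge0 : 0 <= e / (1 + e) by rewrite divr_ge0 // ltW.
have := wconeD (wconeZ c_ge0 xW) (wconeZ c'_ge0 wW); congr wcone.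
  by field; rewrite gt_eqF.
rewrite !scalerA mulVf ?gt_eqF // scale1r.
have -> : e / (1 + e) * ((1 + e) / e) = 1 by field; rewrite !gt_eqF.
by rewrite scale1r subrKC.
Qed.

(** A hull point [y] close to [x] is combined with a short multiple of [x - y] that corrects the
    error. *)
Lemma cl_conv_scale x e : cl_set (conv V) x -> 0 < e < 1 ->
  wcone W 1 ((1 - e) *: vrow x).
Proof.
move=> x_cl /andP[e_gt0 e_lt1]; have [eps eps_gt0 ball] := hull_ball.
have e1 : 0 < 1 - e by rewrite subr_gt0.
have [|y [/convE yW /RltP]] := x_cl (eps * e / (1 - e)).
  by apply/RltP; rewrite divr_gt0 // mulr_gt0.
rewrite vnormE vrow_vsub => y_lt.
have wW : wcone W 1 (- ((1 - e) / e) *: (vrow y - vrow x)).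
  apply: ball; rewrite rnormZ normrN gtr0_norm ?divr_gt0 //.
  by rewrite mulrAC ltr_pdivrMr // mulrC -ltr_pdivlMr.
have := wconeD (wconeZ (ltW e1) yW) (wconeZ (ltW e_gt0) wW); congr wcone; first by ring.
rewrite scalerA mulrN mulrC divfK ?gt_eqF // scaleNr scalerBr opprB.
by rewrite addrC addrNK.
Qed.

Lemma conv_cl x : conv V x -> cl_set (conv V) x.
Proof.
move=> xV eps eps_gt0; exists x; split=> //.
rewrite vnormE vrow_vsub subrr -(scale0r 0) rnormZ normr0 mul0r; exact: eps_gt0.
Qed.

Lemma bd_neq0 x : bd_set (conv V) x -> vrow x != 0.
Proof.
move=> [_ x_nint]; apply/eqP => x0; apply: x_nint.
by rewrite -[x]vrowK x0 -vrow_vzero vrowK.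
Qed.

Lemma segment_bd_opp x y : bd_set (conv V) x -> bd_set (conv V) y ->
  segment x y (vzero d) ->
  exists2 t, 0 < t & vrow y = - t *: vrow x /\
    vnorm (vsub x (vzero d)) / vnorm (vsub y (vzero d)) = t^-1.
Proof.
move=> /bd_neq0 x_neq0 /bd_neq0 y_neq0 [u [[/RleP u_ge0 /RleP u_le1] /(congr1 (@vrow d))]].
rewrite vrow_vzero vrow_vadd !vrow_vscale => /esym/eqP uE.
have u_neq0 : u != 0.
  apply: contraTneq uE => ->; rewrite scale0r addr0 RminusE subr0 scale1r.
  exact: x_neq0.
have u_neq1 : u != 1.
  apply: contraTneq uE => ->; rewrite RminusE subrr scale0r add0r scale1r.
  exact: y_neq0.
have u_gt0 : 0 < u by rewrite lt0r u_neq0.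
have u_lt1 : 0 < 1 - u by rewrite subr_gt0 lt_neqAle u_neq1.
pose t := (1 - u) / u; have t_gt0 : 0 < t by rewrite divr_gt0.
have yE : vrow y = - t *: vrow x.
  apply: (scalerI u_neq0); rewrite scalerA mulrN mulrC divfK // scaleNr.
  by apply/eqP; rewrite -addr_eq0 addrC.
exists t => //; split=> //.
rewrite !vnormE !vrow_vsub vrow_vzero !subr0 yE rnormZ normrN gtr0_norm //.
by rewrite invfM mulrCA divff ?mulr1 // gt_eqF // rnorm_gt0.
Qed.

End HullTopology.

(** * Inequalities describing the standard simplex *)

Section StandardSimplex.
Local Open Scope ring_scope.
Variable d : nat.

Lemma simplexTE (y : vec d) : simplexT d y <->
  (forall i, 0 <= y i) /\ \sum_(i < d) (sylvester i.+1)%:R^-1 * y i <= 1.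
Proof.
rewrite /simplexT; set T := _ :: _.
have sizeT : size T = d.+1 by rewrite /= size_map size_enum_ord.
have nthT (k i : 'I_d) : nth (vzero d) T k.+1 i = if i == k then (sylvester k.+1)%:R else 0.
  by rewrite /= (nth_map k) ?size_enum_ord // nth_ord_enum INRE.
have sumT (F : nat -> R) : \big[Rplus/R0]_(k < size T) F k = F 0%N + \sum_(k < d) F k.+1.
  by rewrite sizeT big_ord_recl.
have s_gt0 (i : 'I_d) : 0 < (sylvester i.+1)%:R :> R by apply: sylvester_gt0.
have combT (lam : nat -> R) i :
    \big[Rplus/R0]_(k < size T) Rmult (lam k) (nth (vzero d) T k i) =
    lam i.+1 * (sylvester i.+1)%:R.
  rewrite (sumT (fun k => Rmult (lam k) (nth (vzero d) T k i))).
  rewrite [X in X + _](_ : _ = 0) ?add0r; last exact: mulr0.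
  under eq_bigr => k _ do rewrite nthT.
  rewrite (bigD1 i) //= eqxx big1 ?addr0 // => k ki.
  by rewrite eq_sym (negPf ki); apply: mulr0.
split=> [[lam [lam_ge0 [sum_lam yE]]]|[y_ge0 sum_y]].
  have {}yE i : y i = lam i.+1 * (sylvester i.+1)%:R by rewrite yE combT.
  split=> [i|]; first by rewrite yE; apply: mulr_ge0; [apply/RleP|apply/ltW].
  have -> : \sum_(i < d) (sylvester i.+1)%:R^-1 * y i = \sum_(i < d) lam i.+1.
    by apply: eq_bigr => i _; rewrite yE mulrC mulfK // gt_eqF.
  by rewrite -[leRHS]sum_lam (sumT lam) lerDr; apply/RleP.
pose lam k : R := if k is k'.+1 then
    if insub k' : option 'I_d is Some i then (sylvester k)%:R^-1 * y i else 0
  else 1 - \sum_(i < d) (sylvester i.+1)%:R^-1 * y i.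
have lamS (i : 'I_d) : lam i.+1 = (sylvester i.+1)%:R^-1 * y i by rewrite /lam valK.
exists lam; split=> [k|].
  apply/RleP; case: k => [|k]; first by rewrite /= subr_ge0.
  rewrite /=; case: insubP => // i _ _.
  by apply: mulr_ge0 => //; rewrite invr_ge0 ltW // sylvester_gt0.
split; last by move=> i; rewrite combT lamS mulrAC mulVf ?mul1r // gt_eqF.
rewrite (sumT lam); under eq_bigr => i _ do rewrite lamS.
by rewrite /= subrK.
Qed.

End StandardSimplex.

(** * Coefficient of asymmetry *)

Section Asymmetry.
Local Open Scope ring_scope.
Variables (d : nat) (d_gt0 : (0 < d)%N) (V : seq (vec d)).
Hypothesis int0 : int_set (conv V) (vzero d).
Let W := vertex_mx V.
Let N : R := (sylv_prod d)%:R.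

Let N_gt1 : 1 < N. Proof. by rewrite ltr1n sylv_prod_gt1. Qed.

Lemma ca_values_opp x t : 0 < t -> bd_set (conv V) x ->
  bd_set (conv V) (vscale (- t)%R x) -> ca_values (conv V) (vzero d) t^-1.
Proof.
move=> t_gt0 x_bd y_bd; have t1 : 1 + t != 0 by rewrite gt_eqF // addr_gt0.
exists x, (vscale (- t)%R x); split=> //; split=> //; split.
  exists ((1 + t)^-1); split.
    split; apply/RleP; first by rewrite invr_ge0 addr_ge0 // ltW.
    by rewrite invf_le1 ?addr_gt0 // lerDl ltW.
  apply/funext => i; rewrite /vadd /vscale /vzero.
  by rewrite !RealsE /=; field.
rewrite RdivE !vnormE !vrow_vsub vrow_vzero !subr0 vrow_vscale rnormZ normrN gtr0_norm //.
by rewrite invfM mulrCA divff ?mulr1 // gt_eqF // rnorm_gt0 // (bd_neq0 int0 x_bd).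
Qed.

(** The origin is mapped to an interior lattice point of [simplexT d], which must be [(1, ..., 1)];
    the chord through it and the vertex 0 has ratio [N - 1]. *)
Lemma unimod_ca_values : unimod_equiv (conv V) (simplexT d) ->
  ca_values (conv V) (vzero d) (N - 1)%R.
Proof.
move=> [f [[A [t fE]] [f_surj [f_inj [f_lattice f_hull]]]]].
have hullE x : conv V x <-> simplexT d (f x).
  split=> [xV|/f_hull[x' [x'V /f_inj <- //]]].
  by apply/f_hull; exists x.
have f_scale c x i : f (vscale c x) i = c * (f x i - t i) + t i.
  rewrite !fE !RplusE addrK mulr_sumr; congr (_ + _).
  by apply: eq_bigr => l _; rewrite /vscale !RmultE; ring.
have f0 : f (vzero d) = t.
  apply/funext => i; rewrite fE RplusE big1 ?add0r // => l _.
  by rewrite /vzero RmultE mulr0.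
have s_gt0 (i : 'I_d) : 0 < (sylvester i.+1)%:R^-1 :> R.
  by rewrite invr_gt0 sylvester_gt0.
have ray y : exists2 e, 0 < e & simplexT d (fun i => e * (y i - t i) + t i).
  have [x xE] := f_surj y; have [e e_gt0 exW] := hull_absorbing int0 (vrow x).
  exists e => //; have /hullE : conv V (vscale e x) by apply/convE; rewrite vrow_vscale.
  by congr simplexT; apply/funext => i; rewrite f_scale xE.
have t_gt0 i : 0 < t i.
  have [e e_gt0 /simplexTE[/(_ i) + _]] := ray (fun i => t i - 1).
  by rewrite addrAC subrr sub0r; lra.
have Ninv : N^-1 < 1 by rewrite invf_lt1 // (lt_trans ltr01).
have sum_t_lt1 : \sum_(i < d) (sylvester i.+1)%:R^-1 * t i < 1.
  have [e e_gt0 /simplexTE[_]] := ray (fun i => t i + 1).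
  under eq_bigr => i _ do rewrite addrAC subrr add0r mulr1 mulrDr.
  rewrite big_split /= -mulr_suml sum_inv_sylvester -/N => le1.
  by have := mulr_gt0 (_ : 0 < 1 - N^-1) e_gt0; rewrite subr_gt0 => /(_ Ninv); lra.
have t_int i : t i \is a Num.int.
  have /latticeE/mxOverP/(_ 0 i) : lattice t by rewrite -f0 -f_lattice => l; exists Z0.
  by rewrite mxE.
have t_ge1 i : 1 <= t i.
  by have /intrP[m mE] := t_int i; have := t_gt0 i; rewrite mE ltr0z -[1]/(1%:~R) ler_int; lia.
have t1 i : t i = 1.
  apply/eqP; rewrite eq_le t_ge1 andbT leNgt; apply/negP => ti_gt1.
  have ti_ge2 : 2 <= t i.
    have /intrP[m mE] := t_int i; move: ti_gt1.
    by rewrite mE -[1]/(1%:~R) -[2]/(2%:~R) ltr_int ler_int; lia.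
  (* The excess over [(1, ..., 1)] is below [N^-1], whereas one coordinate of at least 2 contributes
     [1 / s_i], at least [N^-1]. *)
  have sum_lt : \sum_(l < d) (sylvester l.+1)%:R^-1 * (t l - 1) < N^-1.
    under eq_bigr => l _ do rewrite mulrBr mulr1.
    by rewrite sumrB sum_inv_sylvester -/N; lra.
  have : (sylvester i.+1)%:R^-1 * (t i - 1) < N^-1.
    apply: le_lt_trans sum_lt; rewrite [leRHS](bigD1 i) //= lerDl sumr_ge0 // => l _.
    by rewrite mulr_ge0 ?subr_ge0 ?t_ge1 // ltW.
  have : N^-1 <= (sylvester i.+1)%:R^-1.
    rewrite lef_pV2 ?posrE ?sylvester_gt0 ?(lt_trans ltr01) // ler_nat.
    by rewrite dvdn_leq ?sylv_prod_gt0 // dvdn_sylv_prod.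
  by have := s_gt0 i; nra.
(* The preimage of the vertex 0; the line through it and the origin meets the hull exactly for
   parameters from [- (N - 1)^-1] to 1. *)
have [a fa] := f_surj (vzero d).
have fa_scale c i : f (vscale c a) i = 1 - c.
  by rewrite f_scale fa t1 [vzero d i](_ : _ = 0) //; ring.
have N1 : 0 < N - 1 by rewrite subr_gt0.
have hull_scale c : conv V (vscale c a) <-> c <= 1 /\ (1 - c) * (1 - N^-1) <= 1.
  rewrite hullE simplexTE; under eq_bigr => i _ do rewrite fa_scale.
  rewrite -mulr_suml sum_inv_sylvester -/N mulrC.
  split=> [[/(_ (Ordinal d_gt0)) c_le1 ?]|[c_le1 ?]]; split=> //.
    by move: c_le1; rewrite fa_scale subr_ge0.
  by move=> i; rewrite fa_scale subr_ge0.
have scale1 : vscale 1 a = a by apply/funext => i; rewrite /vscale RmultE mul1r.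
rewrite -[N - 1]invrK; apply: (@ca_values_opp a); first by rewrite invr_gt0.
  split.
    apply: conv_cl; rewrite -scale1; apply/hull_scale; split=> //.
    by rewrite subrr mul0r ler01.
  move=> /(int_convE int0)[e e_gt0]; rewrite -vrow_vscale => /convE/hull_scale[].
  lra.
split.
  apply/conv_cl/hull_scale; split.
    by rewrite (le_trans _ ler01) // oppr_le0 invr_ge0 ltW.
  rewrite le_eqVlt; apply/orP; left; apply/eqP; field.
  by rewrite !gt_eqF // (lt_trans ltr01).
move=> /(int_convE int0)[e e_gt0]; rewrite -vrow_vscale.
have -> : vscale (1 + e)%R (vscale (- (N - 1)^-1)%R a) = vscale (- ((1 + e) / (N - 1)))%R a.
  by apply/funext => i; rewrite /vscale !RmultE; ring.
move=> /convE/hull_scale[_]; apply/negP; rewrite -ltNge.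
have -> : (1 - - ((1 + e) / (N - 1))) * (1 - N^-1) = 1 + e / N.
  by field; rewrite !gt_eqF // (lt_trans ltr01).
by rewrite ltrDl divr_gt0 // (lt_trans ltr01).
Qed.

Hypotheses (V_lattice : forall k, (k < size V)%N -> lattice (nth (vzero d) V k))
  (only_int0 : forall z, lattice z -> int_set (conv V) z -> z = vzero d).

Let W_int : W \is a mxOver Num.int.
Proof.
apply/mxOverP => i l; have /latticeE/mxOverP/(_ 0 l) := V_lattice (ltn_ord i).
by rewrite !mxE.
Qed.

Let only0 r : r \is a mxOver Num.int ->
  (exists2 e, 0 < e & wcone W 1 ((1 + e) *: r)) -> r = 0.
Proof.
rewrite -[r]rvecK => /latticeE r_int /(int_convE int0) r_int'.
by rewrite (only_int0 r_int r_int') vrow_vzero.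
Qed.

(** * The best vertex realizes the coefficient of asymmetry *)

Section BestVertex.
Variables (i0 : 'I_(size V)) (b : 'rV[R]_(size V)).
Hypotheses (b_feas : feasible W b) (b_free : affinely_free W (supp b))
  (b_max : forall b', feasible W b' -> b' 0 i0 <= b 0 i0)
  (b_min : forall i, exists2 b', feasible W b' & b 0 i0 <= b' 0 i).
Let M := b 0 i0.
Let mu := M / (1 - M).
Let absorbing := hull_absorbing int0.
Let mu_gt0 : 0 < mu := best_ratio_gt0 d_gt0 absorbing b_feas b_max b_min.

Lemma best_is_ca : is_ca (conv V) (vzero d) mu^-1.
Proof.
pose a : vec d := rvec (row i0 W).
have ray_max t : mu < t -> ~ wcone W 1 (- t *: row i0 W).
  move=> mu_t tW; have := best_ratio_max d_gt0 absorbing b_feas b_max b_min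
    (ltW (lt_trans mu_gt0 mu_t)) tW.
  by rewrite leNgt mu_t.
have wcone_opp_hull x : wcone W 1 x -> wcone W 1 (- mu *: x).
  exact: (wcone_opp d_gt0 absorbing b_feas b_max b_min).
have mu_lt e : 0 < e -> mu < mu * (1 + e) by move=> e_gt0; rewrite ltr_pMr // ltrDl.
split.
  apply: (@ca_values_opp a) => //; split.
  - by apply/conv_cl/convE; rewrite rvecK; apply: wcone_row.
  - move=> /(int_convE int0)[e /mu_lt e_lt /wcone_opp_hull]; rewrite rvecK scalerA mulNr.
    exact: ray_max.
  - by apply/conv_cl/convE; rewrite vrow_vscale rvecK; apply/wcone_opp_hull/wcone_row.
  - move=> /(int_convE int0)[e /mu_lt e_lt]; rewrite vrow_vscale rvecK scalerA mulrN mulrC.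
    exact: ray_max.
move=> r [x [y [x_bd [y_bd [xy0 ->]]]]]; apply/RleP.
have [t t_gt0 [yE rE]] := segment_bd_opp int0 x_bd y_bd xy0.
rewrite RdivE rE lef_pV2 ?posrE // leNgt; apply/negP => t_mu.
have [_ []] := y_bd; apply/(int_convE int0).
(* With this [e], [mu * (1 - e)] is the midpoint of [t] and [mu], so the reflected point lies
   strictly beyond [y], which makes [y] interior. *)
pose e := (1 - t / mu) / 2.
have tmu : 0 < t / mu < 1 by rewrite divr_gt0 //= ltr_pdivrMr // mul1r.
have e01 : 0 < e < 1 by rewrite /e; lra.
have xW := wcone_opp_hull _ (cl_conv_scale int0 x_bd.1 e01).
pose u := mu * (1 - e) / t - 1.
exists u.
  rewrite /u subr_gt0 ltr_pdivlMr // mul1r -[ltLHS](divfK (lt0r_neq0 mu_gt0)) mulrC.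
  by rewrite ltr_pM2l // /e; lra.
rewrite yE scalerA; move: xW; rewrite scalerA; congr wcone; congr (_ *: _).
by rewrite /u; field; rewrite gt_eqF.
Qed.

Let M_ge : N^-1 <= M :=
  best_weight_ge d_gt0 W_int absorbing only0 b_feas b_free b_max b_min.

Let M_gt0 : 0 < M := best_weight_gt0 absorbing b_max.

Let best_caE : mu^-1 = M^-1 - 1.
Proof.
have := best_weight_lt1 d_gt0 absorbing b_feas b_max b_min; rewrite -subr_gt0 -/M => M1.
by rewrite /mu; field; rewrite !gt_eqF.
Qed.

Lemma best_ca_le : mu^-1 <= N - 1.
Proof.
by rewrite best_caE lerB // -[N]invrK lef_pV2 // posrE invr_gt0 (lt_trans ltr01).
Qed.

Lemma best_ca_eq : mu^-1 = N - 1 -> M = N^-1.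
Proof. by rewrite best_caE => /addIr <-; rewrite invrK. Qed.

(** The equivalence takes Sylvester coordinates with respect to the extremal simplex. *)
Lemma best_ca_unimod : mu^-1 = N - 1 -> unimod_equiv (conv V) (simplexT d).
Proof.
move=> /best_ca_eq ME.
have [v [v_unit v_lattice v_hull]] :=
  extremal_coordinates d_gt0 W_int absorbing only0 b_feas b_free b_max b_min ME.
pose coords (x : vec d) := vrow x *m invmx v.
have coordsK x : coords x *m v = vrow x by rewrite /coords mulmxKV.
pose f (x : vec d) : vec d := fun i => sylv_coord (coords x) i.
have f_inj x x' : f x = f x' -> x = x'.
  move=> ff'; apply: (can_inj (@vrowK d)); rewrite -[LHS]coordsK -[RHS]coordsK.
  by congr (_ *m v); apply: sylv_coord_inj => i; have := congr1 (@^~ i) ff'.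
have f_surj y : exists x, f x = y.
  have [z zE] := sylv_coord_surj y; exists (rvec (z *m v)).
  by apply/funext => i; rewrite /f /coords rvecK mulmxK // zE.
have hullE x : conv V x <-> simplexT d (f x).
  rewrite convE -[vrow x]coordsK; apply: (iff_trans (v_hull _)).
  exact: iff_sym (simplexTE _).
exists f; split; last split=> //; last split=> //; last split.
- exists (fun i l : 'I_d => (sylvester i.+1)%:R * invmx v l i - \sum_j invmx v l j), (fun=> 1).
  move=> x i; rewrite /f /sylv_coord -addrA addrC; congr (_ + _).
  have -> : \sum_l coords x 0 l = \sum_l x l * \sum_j invmx v l j.
    rewrite (eq_bigr (fun j => \sum_l x l * invmx v l j)) => [|j _].
      by rewrite exchange_big; apply: eq_bigr => l _; rewrite mulr_sumr.
    by rewrite mxE; apply: eq_bigr => l _; rewrite mxE.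
  rewrite mxE mulr_sumr -sumrB; apply: eq_bigr => l _.
  by rewrite mxE RmultE; ring.
- move=> x; rewrite !latticeE -[vrow x]coordsK; apply: (iff_trans (v_lattice _)).
  split=> [x_int|/mxOverP x_int i]; last by have := x_int 0 i; rewrite mxE.
  by apply/mxOverP => i l; rewrite mxE; apply: x_int.
- move=> y; split=> [yT|[x [/hullE xT <-]] //]; have [x xE] := f_surj y.
  by exists x; split=> //; apply/hullE; rewrite xE.
Qed.

End BestVertex.

End Asymmetry.

Local Open Scope R_scope.

Theorem mainTheorem7 (d : nat) (Hd : (1 <= d)%N) (V : seq (vec d))
  (HV : forall k, (k < size V)%N -> lattice (nth (vzero d) V k))
  (H0 : int_set (conv V) (vzero d))
  (Hint : forall z, lattice z -> int_set (conv V) z -> z = vzero d) :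
  exists c, is_ca (conv V) (vzero d) c /\
    c <= INR (sylvester d.+1) - 2 /\
    (c = INR (sylvester d.+1) - 2 <-> unimod_equiv (conv V) (simplexT d)).
Proof.
have -> : INR (sylvester d.+1) - 2 = (((sylv_prod d)%:R : R) - 1)%R.
  rewrite INRE RminusE sylvesterE -natr1 -addrA; congr (_ + _)%R.
  by have -> : 2 = (1 + 1 : R)%R by []; rewrite opprD addrA subrr add0r.
have [i0 [b [b_feas b_free b_max b_min]]] := best_vertex (hull_absorbing H0).
have ca := best_is_ca Hd H0 b_feas b_max b_min.
have ca_le := best_ca_le Hd H0 HV Hint b_feas b_free b_max b_min.
exists ((b 0 i0 / (1 - b 0 i0))^-1)%R; split=> //; split; first exact/RleP.
split; first exact: (best_ca_unimod Hd H0 HV Hint b_feas b_free b_max b_min).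
(* Conversely, an equivalence makes the upper bound an attained ratio, so the maximum reaches it. *)
move=> /(unimod_ca_values Hd H0) /(proj2 ca)/RleP ca_ge.
by apply/eqP; rewrite eq_le ca_le.
Qed.
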